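(* Let $E$ be a Polish space, let $(\varphi,\vartheta)$ be a random dynamical system (RDS) on $E$ over $(\Omega,\mathscr F,\mathbb P,(\vartheta_t)_{t\in\mathbb T_1})$ with time set $\mathbb T_2$, and let $\mathcal B$ be an arbitrary family of sets $B\subset E\times\Omega$ (no measurability is assumed). (i) Assume that there exists a random set $\mathcal K\subset E\times\Omega$ such that $\mathcal K(\omega)$ is compact for $\mathbb P$-almost all $\omega$ and $\mathcal K$ attracts $\mathcal B$ in the sense that $$\lim_{t\to\infty} d\bigl(\varphi(t,\vartheta_{-t}\omega)B(\vartheta_{-t}\omega),\mathcal K(\omega)\bigr)=0\quad\text{in probability}$$ for every $B\in\mathcal B$. Then $(\varphi,\vartheta)$ admits at least one weak random attractor for $\mathcal B$. (ii) If $(\varphi,\vartheta)$ has a weak random attractor for $\mathcal B$, then it has a minimal weak random attractor $A$ for $\mathcal B$. In addition, there is a countable sub-family $\mathcal B_1\subset\mathcal B$ such that $A$ is also the minimal weak random attractor for $\mathcal B_1$. (iii) If $\mathcal K$ is as in the hypothesis of (i), then the minimal weak random attractor $A$ for $\mathcal B$ satisfies $A(\omega)\subset\mathcal K(\omega)$ almost surely.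
   Context: Setting. $E$ is a Polish space with Borel $\sigma$-algebra $\mathcal E$; $d$ is a complete metric generating its topology. For $x\in E$, $A\subset E$: $d(x,A)=\inf\{d(x,a):a\in A\}$, $d(x,\emptyset)=\infty$. For non-empty $A,B\subset E$, $d(B,A):=\sup\{d(b,A):b\in B\}$ (Hausdorff semi-metric); $d(\emptyset,A):=0$, and $d(B,\emptyset):=\infty$ if $B\ne\emptyset$. $(\Omega,\mathscr F,\mathbb P)$ is a probability space, $\mathbb T_1\in\{\mathbb Z,\mathbb R\}$, and $\vartheta:\mathbb T_1\times\Omega\to\Omega$, $(t,\omega)\mapsto\vartheta_t\omega$, is measurable, each $\vartheta_t$ preserves $\mathbb P$, $\vartheta_{t+s}=\vartheta_t\circ\vartheta_s$ and $\vartheta_0=\mathrm{id}$. Let $\mathbb T_2\in\{\mathbb R,[0,\infty),\mathbb Z,\mathbb N_0\}$ with $\mathbb T_2\subseteq\mathbb T_1$. An RDS is a measurable map $\varphi:\mathbb T_2\times E\times\Omega\to E$, $(t,x,\omega)\mapsto\varphi(t,\omega)x$, such that for all $\omega\in\Omega$: $\varphi(t,\omega):E\to E$ is continuous for every $t\in\mathbb T_2$; $\varphi(t+s,\omega)=\varphi(t,\vartheta_s\omega)\circ\varphi(s,\omega)$ for all $s,t\in\mathbb T_2$; $\varphi(0,\omega)=\mathrm{id}$. (No continuity in $t$ is assumed.) Times $t$ in limits and invariance conditions range over $\mathbb T_2$. For $C\subset E\times\Omega$ put $C(\omega)=\{x:(x,\omega)\in C\}$. A random set is an element of $\mathcal E\otimes\mathscr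 F$. A closed (resp. compact) random set is a set $C\subset E\times\Omega$ all of whose sections $C(\omega)$ are closed (resp. compact) and for which $\omega\mapsto d(x,C(\omega))\in[0,\infty]$ is measurable for every $x\in E$ (such a set is a random set). A property depending on $\omega$ holds almost surely if there is a measurable set of full measure on which it holds. For possibly non-measurable functions $Y_t:\Omega\to[0,\infty]$, ''$Y_t\to0$ in probability'' means $\mathbb P^*(Y_t\ge\varepsilon)\to0$ as $t\to\infty$ for every $\varepsilon>0$, where $\mathbb P^*(S)=\inf\{\mathbb P(M):M\in\mathscr F,\ M\supset S\}$. A weak random attractor for $\mathcal B$ is a set $A\subset E\times\Omega$ such that: $A$ is a compact random set; $A$ is strictly invariant, i.e. for every $t\in\mathbb T_2$, $t\ge0$, $\varphi(t,\omega)A(\omega)=A(\vartheta_t\omega)$ $\mathbb P$-a.s.; and for every $B\in\mathcal B$, $\lim_{t\to\infty}d(\varphi(t,\omega)B(\omega),A(\vartheta_t\omega))=0$ in probability. It is minimal (in the sense of smallest) if $A(\omega)\subset A'(\omega)$ almost surely for every weak random attractor $A'$ for $\mathcal B$. *)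

(* Defs.v *)
From HB Require Import structures.
From mathcomp Require Import all_boot all_order all_algebra.
From mathcomp Require Import all_classical all_reals all_analysis.
From mathcomp Require Import measurable_realfun.

Set Implicit Arguments.
Unset Strict Implicit.
Unset Printing Implicit Defensive.

Import Order.TTheory GRing.Theory Num.Theory.
Import numFieldNormedType.Exports.

Local Open Scope classical_set_scope.
Local Open Scope ring_scope.

(* [mdist] is the complete metric; [Complete] carries a base point. *)
#[short(type="completeMetricType")]
HB.structure Definition CompleteMetric (R : numDomainType) :=
  { T of Complete T & Metric R T }.

Definition separable (T : topologicalType) : Prop :=
  exists2 D : set T, countable D & dense D.

Notation borel E := (g_sigma_algebraType (@open E)).

Definition int_times (R : realType) : set R := range (fun k : int => k%:~R).
Definition nat_times (R : realType) : set R := range (fun n : nat => n%:R).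

(* Time sets are realized as subsets of R; the trace of the Borel sigma-algebra
   of R on the integers is discrete. *)
Definition time_sets (R : realType) (T1 T2 : set R) : Prop :=
  [/\ T1 = setT \/ T1 = @int_times R,
      [\/ T2 = setT, T2 = [set t | 0 <= t], T2 = @int_times R
        | T2 = @nat_times R] &
      T2 `<=` T1].

(* The values of [theta t] for t outside T1, and of [phi t] for t outside T2,
   are irrelevant. *)
Record metric_dynamical_system (R : realType) (d : measure_display)
    (Omega : measurableType d) (P : probability Omega R)
    (T1 : set R) (theta : R -> Omega -> Omega) : Prop := {
  mds_measurable : measurable_fun (T1 `*` [set: Omega])
    (fun p : R * Omega => theta p.1 p.2);
  mds_preserving : forall t, T1 t -> forall F : set Omega, measurable F ->
    P (theta t @^-1` F) = P F;
  mds_add : forall t s, T1 t -> T1 s -> theta (t + s) = theta t \o theta s;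
  mds_0 : theta 0 = id }.

Record random_dynamical_system (R : realType) (d : measure_display)
    (Omega : measurableType d) (E : completeMetricType R)
    (theta : R -> Omega -> Omega) (T2 : set R)
    (phi : R -> Omega -> E -> E) : Prop := {
  rds_measurable : measurable_fun (T2 `*` [set: borel E] `*` [set: Omega])
    (fun p : R * borel E * Omega => (phi p.1.1 p.2 p.1.2 : borel E));
  rds_continuous : forall w t, T2 t -> continuous (phi t w);
  rds_cocycle : forall w s t, T2 s -> T2 t ->
    phi (t + s) w = phi t (theta s w) \o phi s w;
  rds_0 : forall w, phi 0 w = id }.

Definition point_dist (R : realType) (E : completeMetricType R)
    (x : E) (A : set E) : \bar R :=
  ereal_inf [set (mdist x a)%:E | a in A].

(* The maximum with 0 only matters for B = set0, where the supremum is -oo. *)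
Definition semi_dist (R : realType) (E : completeMetricType R)
    (B A : set E) : \bar R :=
  maxe 0%E (ereal_sup [set point_dist b A | b in B]).

Definition random_set (R : realType) (d : measure_display)
    (Omega : measurableType d) (E : completeMetricType R)
    (C : set (E * Omega)) : Prop :=
  measurable (C : set (borel E * Omega)).

(* The section of C at w is [ysection C w]. *)
Definition compact_random_set (R : realType) (d : measure_display)
    (Omega : measurableType d) (E : completeMetricType R)
    (C : set (E * Omega)) : Prop :=
  (forall w, compact (ysection C w)) /\
  (forall x : E,
     measurable_fun [set: Omega] (fun w => point_dist x (ysection C w))).

Definition outer_prob (R : realType) (d : measure_display)
    (Omega : measurableType d) (P : probability Omega R)
    (S : set Omega) : \bar R :=
  ereal_inf [set P M | M in [set M | measurable M /\ S `<=` M]].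

(* The Y t need not be measurable. *)
Definition cvg0_in_probability (R : realType) (d : measure_display)
    (Omega : measurableType d) (P : probability Omega R)
    (T2 : set R) (Y : R -> Omega -> \bar R) : Prop :=
  forall e : R, 0 < e ->
    outer_prob P [set w | (e%:E <= Y t w)%E] @[t --> within T2 (pinfty_nbhs R)]
      --> 0%E.

Definition weak_random_attractor (R : realType) (d : measure_display)
    (Omega : measurableType d) (P : probability Omega R)
    (E : completeMetricType R) (theta : R -> Omega -> Omega) (T2 : set R)
    (phi : R -> Omega -> E -> E) (BB : set (set (E * Omega)))
    (A : set (E * Omega)) : Prop :=
  [/\ compact_random_set A,
      forall t, T2 t -> 0 <= t ->
        {ae P, forall w, phi t w @` ysection A w = ysection A (theta t w)} &
      forall B, BB B -> cvg0_in_probability P T2 (fun t w =>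
        semi_dist (phi t w @` ysection B w) (ysection A (theta t w)))].

Definition minimal_weak_random_attractor (R : realType) (d : measure_display)
    (Omega : measurableType d) (P : probability Omega R)
    (E : completeMetricType R) (theta : R -> Omega -> Omega) (T2 : set R)
    (phi : R -> Omega -> E -> E) (BB : set (set (E * Omega)))
    (A : set (E * Omega)) : Prop :=
  weak_random_attractor P theta T2 phi BB A /\
  forall A', weak_random_attractor P theta T2 phi BB A' ->
    {ae P, forall w, ysection A w `<=` ysection A' w}.

Definition compact_attracting_set (R : realType) (d : measure_display)
    (Omega : measurableType d) (P : probability Omega R)
    (E : completeMetricType R) (theta : R -> Omega -> Omega) (T2 : set R)
    (phi : R -> Omega -> E -> E) (BB : set (set (E * Omega)))
    (K : set (E * Omega)) : Prop :=
  [/\ random_set K,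
      {ae P, forall w, compact (ysection K w)} &
      forall B, BB B -> cvg0_in_probability P T2 (fun t w =>
        semi_dist (phi t (theta (- t) w) @` ysection B (theta (- t) w))
                  (ysection K w))].

(* Main.v *)
Require Import Defs.
From mathcomp Require Import all_boot all_order all_algebra.
From mathcomp Require Import all_classical all_reals all_analysis.
From mathcomp Require Import measurable_realfun.
From mathcomp Require Import lra.

(** Why the theorem is true. A compact random set is handled as a map A from
    Omega to the compact subsets of E such that the event that A meets a given
    ball is measurable ([rcompact]). As theta preserves P, pullback and forward
    attraction in probability are the same ([pullback_attracts]). Therefore the
    weak attractors of a family BB are the strictly invariant elements of the
    class [attracting BB] of the compact random sets that attract every member
    of BB, and the proof consists in studying this class.

    The class is stable under countable intersections. At a fixed w this is
    compactness: points close to sufficiently many of the compact sets are close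
    to their intersection. How close they have to be depends on w, but one choice
    is good outside an event of small probability ([shrinking_near]), and
    attraction in probability ignores such events. Measurability is checked
    along a dense sequence of E, by means of open conditions. A nonempty class
    with this stability has an almost surely smallest element: intersect
    countably many members whose probabilities of meeting the balls of a
    countable base are nearly minimal ([essential_minimum]).

    The smallest element L is strictly invariant, because two other sets
    built from it belong to the class and hence contain it: the image of L under
    the cocycle ([least_sub_image]) and the set of points of L that the cocycle
    maps into L ([least_image_sub]). So L is a weak attractor, and the minimal
    one.

    The smallest set grows with the family that it has to attract. A countable
    subfamily BB1 that maximizes the probabilities of meeting balls has a
    smallest set that does not grow when one further B is added; this set
    therefore attracts all of BB ([least_countable_subfamily]).

    The set K of the statement is only measurable in the product, so the
    distance to its sections need not be a random variable. It agrees almost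
    surely with a compact random set ([measurable_compact_rcompact]), thanks to
    the measurable projection theorem up to null sets ([scheme_projection]).
    That theorem is proved for Souslin sets, which include the measurable ones,
    by taking measurable hulls along the branches of a Souslin scheme. Once K is
    replaced in this way, it belongs to the class, which is thus nonempty and
    has its smallest element almost surely inside K. *)

Set Implicit Arguments.
Unset Strict Implicit.
Unset Printing Implicit Defensive.

Import Order.TTheory GRing.Theory Num.Theory.
Import numFieldNormedType.Exports.

Local Open Scope classical_set_scope.
Local Open Scope ring_scope.

(** * Points near compact sets *)

Section metric.
Context {R : realType} {E : completeMetricType R}.
Implicit Types (A : set E) (x y z : E) (r e : R).

(** Distances to sets enter only through the strict inequality that this
    predicate expresses; this avoids extended real values and makes the empty
    set harmless, since nothing is near it. *)
Definition hits A x r := exists2 a, A a & mdist x a < r.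

Lemma hitsW A x r r' : r <= r' -> hits A x r -> hits A x r'.
Proof. by move=> rr' [a Aa xa]; exists a => //; exact: lt_le_trans rr'. Qed.

Lemma hits_shift A x y r e : mdist x y < e -> hits A y r -> hits A x (r + e).
Proof.
move=> xy [a Aa ya]; exists a => //; rewrite addrC.
by rewrite (le_lt_trans (metric_triangle x y a))// ltrD.
Qed.

Lemma hitsS A B x r : A `<=` B -> hits A x r -> hits B x r.
Proof. by move=> AB [a /AB Ba xa]; exists a. Qed.

Lemma hits_open A x r : hits A x r ->
  exists2 e, 0 < e & forall y, mdist x y < e -> hits A y r.
Proof.
move=> [a Aa xa]; exists (r - mdist x a); first by rewrite subr_gt0.
move=> y xy; exists a => //; rewrite (le_lt_trans (metric_triangle y x a))//.
by rewrite metric_sym -ltrBrDr.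
Qed.

Lemma open_mdistP (U : set E) :
  open U <-> forall x, U x -> exists2 e, 0 < e & forall y, mdist x y < e -> U y.
Proof.
rewrite openE; split=> [oU x /oU|H x Ux].
  by move=> /metricType_numDomainType.nbhs_mdistP[e e0 eU]; exists e.
apply/metricType_numDomainType.nbhs_mdistP.
by have [e e0 eU] := H x Ux; exists e.
Qed.

Lemma closed_mdistP A :
  closed A <-> forall x, (forall e, 0 < e -> hits A x e) -> A x.
Proof.
split=> [cA x h|h x clx].
  apply: cA => U /metricType_numDomainType.nbhs_mdistP[e /= e0 eU].
  by have [a Aa xa] := h _ e0; exists a; split => //; exact: eU.
apply: h => e e0.
have /clx[a [Aa]] : nbhs x [set y | mdist x y < e].
  by apply/metricType_numDomainType.nbhs_mdistP; exists e.
by exists a.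
Qed.

Lemma open_mdist_lt x r : open [set y | mdist x y < r].
Proof.
apply/open_mdistP => y /= xy; exists (r - mdist x y); first by rewrite subr_gt0.
by move=> z yz; rewrite (le_lt_trans (metric_triangle x y z))// addrC -ltrBrDr.
Qed.

Lemma closed_mdist_le x r : closed [set y | mdist x y <= r].
Proof.
apply/closed_mdistP => y h /=; apply/ler_addgt0Pr => e /h[z /= xz yz].
rewrite (le_trans (metric_triangle x z y))// lerD//.
by rewrite metric_sym ltW.
Qed.

Lemma continuous_mdistP (f : E -> E) : continuous f <->
  forall x e, 0 < e ->
    exists2 e', 0 < e' & forall y, mdist x y < e' -> mdist (f x) (f y) < e.
Proof.
split=> [cf x e e0|h x].
  have /metricType_numDomainType.cvgr_dist_lt/(_ _ e0) := cf x.
  by move=> /metricType_numDomainType.nbhs_mdistP[e' e'0 h]; exists e'.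
apply/metricType_numDomainType.cvgrPdist_lt => e /(h x)[e' e'0 xe'].
by apply/metricType_numDomainType.nbhs_mdistP; exists e'.
Qed.

Lemma compact_closed_mdist A : compact A -> closed A.
Proof. by apply: compact_closed; exact: metric_hausdorff. Qed.

Definition cluster_point (u : nat -> E) z :=
  forall e N, 0 < e -> exists2 n, (N <= n)%N & mdist z (u n) < e.

Lemma compact_cluster_point A (u : nat -> E) :
  compact A -> (forall n, A (u n)) -> exists2 z, A z & cluster_point u z.
Proof.
move=> cA Au; have [|z [Az uz]] := cA (u @ \oo) _.
  by exists 0%N => // n _ /=; exact: Au.
exists z => // e N e0.
have : (u @ \oo) (u @` [set n | (N <= n)%N]).
  by exists N => // n /= Nn; exists n.
have : nbhs z [set y | mdist z y < e].
  by apply/metricType_numDomainType.nbhs_mdistP; exists e.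
by move=> /[swap] /uz /[apply] -[_ [[n Nn <-] zn]]; exists n.
Qed.

Definition tol n : R := n.+1%:R^-1.

Lemma tol_gt0 n : 0 < tol n. Proof. by rewrite invr_gt0 ltr0n. Qed.

Lemma tol_le m n : (m <= n)%N -> tol n <= tol m.
Proof. by move=> mn; rewrite /tol lef_pV2 ?posrE ?ltr0n// ler_nat ltnS. Qed.

Lemma tol_lt e : 0 < e -> exists n, tol n < e.
Proof.
move=> e0; have [n _ /(_ n (leqnn _))] := near_infty_natSinv_lt (PosNum e0).
by exists n.
Qed.

Lemma cluster_point_near A (u v : nat -> E) :
  compact A -> (forall n, A (u n)) -> (forall n, mdist (v n) (u n) < tol n) ->
  exists2 z, A z & cluster_point v z.
Proof.
move=> cA Au uv; have [z Az uz] := compact_cluster_point cA Au.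
exists z => // e N e0; have e20 : 0 < e / 2 by rewrite divr_gt0.
have [m me] := tol_lt e20.
have [n Nn zn] := uz (e / 2) (maxn m N) e20; exists n.
  exact: leq_trans (leq_maxr _ _) Nn.
rewrite (le_lt_trans (metric_triangle z (u n) (v n)))// (splitr e) ltrD//.
rewrite metric_sym (lt_trans (uv n))// (le_lt_trans _ me)// tol_le//.
exact: leq_trans (leq_maxl _ _) Nn.
Qed.

(** The lower bound N is there because the condition coming from the k-th
    constraint of a countable family is imposed from stage k on only. *)
Lemma cluster_hits N A (u : nat -> E) z : closed A ->
  (forall n, (N <= n)%N -> hits A (u n) (tol n)) -> cluster_point u z -> A z.
Proof.
move=> /closed_mdistP cA uA uz; apply: cA => e e0.
have e20 : 0 < e / 2 by rewrite divr_gt0.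
have [m me] := tol_lt e20; have [n mn zn] := uz _ (maxn m N) e20.
rewrite (splitr e); apply: hits_shift zn _; apply: hitsW (uA n _).
  by rewrite (le_trans (tol_le (leq_trans (leq_maxl _ _) mn)))// ltW.
exact: leq_trans (leq_maxr _ _) mn.
Qed.

Lemma compact_hits_cluster A (u : nat -> E) : compact A ->
  (forall n, hits A (u n) (tol n)) -> exists2 z, A z & cluster_point u z.
Proof.
move=> cA uA.
have [v vP] : {v : nat -> E & forall n, A (v n) /\ mdist (u n) (v n) < tol n}.
  by apply: (@choice _ _ (fun n a => A a /\ mdist (u n) a < tol n)) => n;
    have [a Aa ua] := cid2 (uA n); exists a.
by apply: (@cluster_point_near _ v) => // n; have [] := vP n.
Qed.

Lemma cluster_point_cont (f : E -> E) (u : nat -> E) z : continuous f ->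
  cluster_point u z -> cluster_point (f \o u) (f z).
Proof.
move=> /continuous_mdistP cf uz e N e0; have [e' e'0 fe] := cf z _ e0.
by have [n Nn zn] := uz e' N e'0; exists n => //; exact: fe.
Qed.

Lemma point_dist_lt x A r : (point_dist x A < r%:E)%E <-> hits A x r.
Proof.
split=> [/ereal_inf_lt[_ /= [a Aa <-]]|[a Aa xa]].
  by rewrite lte_fin; exists a.
rewrite (@le_lt_trans _ _ (mdist x a)%:E)// ?lte_fin//.
by apply: ereal_inf_lbound; exists a.
Qed.

(** Together with [semi_dist_far], this lets the Hausdorff semi-metric be
    replaced by the existence of a point of B at distance at least e from A: the
    two conditions imply each other up to a decrease of e, which convergence in
    probability does not see. *)
Lemma semi_dist_ge (B A : set E) e : 0 < e ->
  (exists2 b, B b & ~ hits A b e) -> (e%:E <= semi_dist B A)%E.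
Proof.
move=> e0 [b Bb bA]; rewrite /semi_dist le_max; apply/orP; right.
apply: (@le_trans _ _ (point_dist b A)).
  by rewrite leNgt; apply/negP => /point_dist_lt.
by apply: ereal_sup_ubound; exists b.
Qed.

Lemma semi_dist_far (B A : set E) e e' : 0 < e' -> e' < e ->
  (e%:E <= semi_dist B A)%E -> exists2 b, B b & ~ hits A b e'.
Proof.
move=> e0 ee'; rewrite /semi_dist le_max => /orP[|h].
  by rewrite lee_fin => /(lt_le_trans (lt_trans e0 ee')); rewrite ltxx.
have /ereal_sup_gt[_ [b Bb <-]] : (e'%:E < ereal_sup [set point_dist b A | b in B])%E.
  by apply: lt_le_trans h; rewrite lte_fin.
move=> h'; exists b => // /point_dist_lt; apply/negP.
by rewrite -leNgt ltW.
Qed.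

Lemma separable_seq : separable E ->
  exists q : nat -> E, forall x e, 0 < e -> exists k, mdist x (q k) < e.
Proof.
move=> [D /countable_injP[f fi] dD].
exists (fun n => xget point [set x | D x /\ f x = n]) => x e e0.
have [y [/= xy Dy]] : ([set y | mdist x y < e] `&` D) !=set0.
  by apply: dD; [exists x; rewrite /= mdistxx | exact: open_mdist_lt].
exists (f y); case: xgetP => [z -> [Dz /fi]|/(_ y)]; last by move=> /not_andP[].
by move=> /(_ (mem_set Dz) (mem_set Dy)) ->.
Qed.

End metric.

#[global] Hint Resolve tol_gt0 : core.

(** * Projections of measurable sets *)

Section projection.
Context {R : realType} {E : completeMetricType R}.
Context {d : measure_display} {Omega : measurableType d}.
Variable q : nat -> E.
Hypothesis q_dense : forall x (e : R), 0 < e -> exists k, mdist x (q k) < e.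

(** A Souslin scheme indexed by infinite sequences instead of finite ones:
    the n-th cell depends on the sequence s only through some finite prefix,
    whose length may vary with s. This continuity requirement makes schemes
    stable under recoding of s, so countable unions and intersections need no
    bookkeeping of prefixes. The last field, that cells get arbitrarily thin in
    E, is what later allows a point of E to be found by completeness. *)
Record scheme := Scheme {
  cellE : nat -> (nat -> nat) -> set E;
  cellO : nat -> (nat -> nat) -> set Omega;
  cellE_closed : forall n s, closed (cellE n s);
  cellO_measurable : forall n s, measurable (cellO n s);
  cell_local : forall n s, exists N, forall s',
    (forall i, (i < N)%N -> s' i = s i) -> cellE n s' = cellE n s /\ cellO n s' = cellO n s;
  cellE_thin : forall s (e : R), 0 < e -> exists n, forall x y,
    cellE n s x -> cellE n s y -> mdist x y < e }.

Definition scheme_set (K : scheme) : set (E * Omega) :=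
  [set p | exists s, forall n, cellE K n s p.1 /\ cellO K n s p.2].

Definition souslin (S : set (E * Omega)) := exists K, S = scheme_set K.

Definition dec_pair m : nat * nat := odflt (0, 0)%N (choice.unpickle m).

Lemma dec_pairK p : dec_pair (choice.pickle p) = p.
Proof. by rewrite /dec_pair choice.pickleK. Qed.

(** The first term of the sequence selects the index of the union, the
    remaining ones drive the scheme selected. *)
Lemma souslin_bigcup (S : nat -> set (E * Omega)) :
  (forall i, souslin (S i)) -> souslin (\bigcup_i S i).
Proof.
move=> /choice[K SK]; pose sh (s : nat -> nat) i := s i.+1.
unshelve eexists (@Scheme (fun n s => cellE (K (s 0)) n (sh s))
  (fun n s => cellO (K (s 0)) n (sh s)) _ _ _ _).
- by move=> *; exact: cellE_closed.
- by move=> *; exact: cellO_measurable.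
- move=> n s; have [N NP] := cell_local (K (s 0)) n (sh s); exists N.+1 => s' s's.
  by rewrite (s's 0) //; apply: NP => i iN; exact: s's.
- by move=> s e; exact: cellE_thin.
apply/seteqP; split=> [[x w] [i _]|[x w] [s sP]].
  rewrite SK => -[s sP].
  by exists (fun j => if j is j'.+1 then s j' else i) => n; exact: sP.
by exists (s 0) => //; rewrite SK; exists (sh s).
Qed.

(** One sequence encodes countably many, through an injective coding of
    pairs of indices: a point lies in the intersection iff each scheme has its
    own witnessing sequence. *)
Lemma souslin_bigcap (S : nat -> set (E * Omega)) :
  (forall i, souslin (S i)) -> souslin (\bigcap_i S i).
Proof.
move=> /choice[K SK].
pose sub (s : nat -> nat) (i j : nat) := s (choice.pickle (i, j)).
unshelve eexists (@Scheme
  (fun m s => cellE (K (dec_pair m).1) (dec_pair m).2 (sub s (dec_pair m).1))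
  (fun m s => cellO (K (dec_pair m).1) (dec_pair m).2 (sub s (dec_pair m).1))
  _ _ _ _).
- by move=> *; exact: cellE_closed.
- by move=> *; exact: cellO_measurable.
- move=> m s /=; case: (dec_pair m) => i n /=.
  have [N NP] := cell_local (K i) n (sub s i).
  exists (\max_(j < N) (choice.pickle (i, nat_of_ord j)).+1)%N => s' s's.
  apply: (NP (sub s' i)) => j jN; apply: s's.
  exact: (@bigop.leq_bigmax _
    (fun j : 'I_N => (choice.pickle (i, nat_of_ord j)).+1) (Ordinal jN)).
- move=> s e /(cellE_thin (K 0) (sub s 0))[n nP].
  by exists (choice.pickle (0, n)%N) => x y; rewrite dec_pairK; exact: nP.
apply/seteqP; split=> [[x w] xw|[x w] [s sP] i _].
  have /choice[s sP] : forall i, exists s, forall n, cellE (K i) n s x /\ cellO (K i) n s w.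
    by move=> i; have := xw i I; rewrite SK.
  exists (fun m => s (dec_pair m).1 (dec_pair m).2) => m /=.
  rewrite (_ : sub _ _ = s (dec_pair m).1); first exact: sP.
  by apply/funext => j; rewrite /sub/= dec_pairK.
rewrite SK; exists (sub s i) => n.
by have := sP (choice.pickle (i, n)); rewrite /= dec_pairK.
Qed.

(** The sequence serves only to locate the point of E: its n-th term names
    a ball of radius tol n centred in the dense sequence, which makes the cells
    thin. *)
Lemma souslin_rect (A : set E) (M : set Omega) :
  closed A -> measurable M -> souslin (A `*` M).
Proof.
move=> cA mM.
unshelve eexists (@Scheme (fun n s => A `&` [set y | mdist (q (s n)) y <= tol n])
  (fun n s => M) _ _ _ _) => //.
- by move=> n s; apply: closedI => //; exact: closed_mdist_le.
- by move=> n s; exists n.+1 => s' -> .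
- move=> s e e0; have [n ne] : exists n, tol n < e / 2 by apply: tol_lt; rewrite divr_gt0.
  exists n => x y [_ /= qx] [_ /= qy].
  rewrite (le_lt_trans (metric_triangle x (q (s n)) y))// metric_sym.
  by rewrite (le_lt_trans (lerD qx qy))// (splitr e) ltrD.
apply/seteqP; split=> [[x w] [/= Ax Mw]|[x w] [s sP]]; last first.
  by have [/= [Ax _] Mw] := sP 0; split.
have /choice[s sP] : forall n, exists k, mdist x (q k) < tol n.
  by move=> n; exact: q_dense.
by exists s => n; split=> //=; split => //=; rewrite metric_sym ltW.
Qed.

Lemma open_bigcup_closed (U : set E) : open U ->
  exists2 A : nat -> set E, forall n, closed (A n) & U = \bigcup_n A n.
Proof.
move=> /open_mdistP oU; exists (fun n => [set x | forall y, mdist x y < tol n -> U y]).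
  move=> n; apply/closed_mdistP => x xA y xy.
  have [z /= zU xz] : hits [set x | forall y, mdist x y < tol n -> U y] x (tol n - mdist x y).
    by apply: xA; rewrite subr_gt0.
  apply: zU; rewrite (le_lt_trans (metric_triangle z x y))// metric_sym.
  by rewrite -ltrBrDr.
apply/seteqP; split=> [x /oU[e e0 eU]|x [n _ /=]].
  have [n ne] := tol_lt e0; exists n => // y xy; apply: eU; exact: lt_trans ne.
by move=> h; apply: h; rewrite mdistxx tol_gt0.
Qed.

Lemma souslin_open (U : set E) : open U -> souslin (U `*` setT).
Proof.
move=> /open_bigcup_closed[A cA ->].
rewrite (_ : _ `*` _ = \bigcup_n (A n `*` setT)); last first.
  apply/seteqP; split=> [[x w] [[n _ An] _]|[x w] [n _ [/= An _]]]; first by exists n.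
  by split => //; exists n.
by apply: souslin_bigcup => i; apply: souslin_rect.
Qed.

(** Souslin sets are not stable under complement. Requiring the property of
    the complement too yields a sigma-algebra, since countable unions and
    intersections are both available. *)
Definition bisouslin (S : set (E * Omega)) := souslin S /\ souslin (~` S).

Lemma bisouslin_sigma_algebra : sigma_algebra setT bisouslin.
Proof.
split.
- split; first by rewrite -(set0X [set: Omega]); exact: souslin_rect closed0 _.
  by rewrite setC0 -setXTT; exact: souslin_rect closedT _.
- by move=> A [sA sAC]; rewrite setTD; split; rewrite ?setCK.
- move=> F sF; split.
    by apply: souslin_bigcup => i; case: (sF i).
  by rewrite setC_bigcup; apply: souslin_bigcap => i; case: (sF i).
Qed.

Lemma bisouslinC S : bisouslin S -> bisouslin (~` S).
Proof. by case=> ? ?; split; rewrite ?setCK. Qed.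

Lemma bisouslinI S T : bisouslin S -> bisouslin T -> bisouslin (S `&` T).
Proof.
move=> sS sT; rewrite -(setCK (S `&` T)); apply: bisouslinC.
rewrite setCI -bigcup2E; have [h0 _ hU] := bisouslin_sigma_algebra.
by apply: hU => -[|[|n]] /=; [exact: bisouslinC|exact: bisouslinC|].
Qed.

Lemma bisouslin_borel (A : set (borel E)) : measurable A ->
  bisouslin ((A : set E) `*` setT).
Proof.
have [h0 hC hU] := bisouslin_sigma_algebra.
suff : <<s @open E >> `<=` [set A | bisouslin (A `*` setT)] by apply.
apply: smallest_sub => /=.
  split=> /=; first by rewrite set0X.
    move=> B sB; rewrite setTD (_ : _ `*` _ = ~` (B `*` setT)); first exact: bisouslinC.
    apply/seteqP; split=> [[x w] /= [h _] []//|[x w] /= h].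
    by split => // Bx; exact: h.
  move=> F sF; rewrite (_ : _ `*` _ = \bigcup_n (F n `*` setT)); first exact: hU.
  apply/seteqP; split=> [[x w] [[n _ An] _]|[x w] [n _ [/= An _]]]; first by exists n.
  by split => //; exists n.
move=> U oU; split; first exact: souslin_open.
rewrite (_ : ~` _ = (~` U) `*` setT).
  by apply: souslin_rect => //; exact: open_closedC.
apply/seteqP; split=> [[x w] /= h|[x w] /= [h _] []//].
by split => // Bx; exact: h.
Qed.

Lemma bisouslin_measurable (M : set Omega) : measurable M ->
  bisouslin ([set: E] `*` M).
Proof.
move=> mM; split; first exact: souslin_rect closedT mM.
rewrite (_ : ~` _ = [set: E] `*` (~` M)).
  by apply: souslin_rect; [exact: closedT|exact: measurableC].
apply/seteqP; split=> [[x w] /= h|[x w] /= [_ h] []//].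
by split => // Bx; exact: h.
Qed.

Lemma measurable_souslin (S : set (borel E * Omega)) :
  measurable S -> souslin (S : set (E * Omega)).
Proof.
move=> mS; suff: bisouslin S by case.
move: S mS; rewrite measurable_prod_measurableType; apply: smallest_sub.
  exact: bisouslin_sigma_algebra.
move=> _ [A mA [M mM] <-].
rewrite (_ : A `*` M = (A `*` setT) `&` (setT `*` M)).
  by apply: bisouslinI; [exact: bisouslin_borel|exact: bisouslin_measurable].
by apply/seteqP; split=> [[x w] []//|[x w] [] [? _] []].
Qed.

End projection.

Section projection_theorem.
Context {R : realType} {E : completeMetricType R}.
Context {d : measure_display} {Omega : measurableType d}.
Variable P : probability Omega R.

Lemma ae_forall_count (T : countType) (Q : T -> Omega -> Prop) :
  (forall i, {ae P, forall w, Q i w}) -> {ae P, forall w i, Q i w}.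
Proof.
move=> aeQ.
have : {ae P, forall w (m : nat), forall i, choice.unpickle m = Some i -> Q i w}.
  apply: ae_foralln => m; case: (choice.unpickle m) => [i|]; last by apply: aeW.
  by apply: filterS (aeQ i) => w Qw j [<-].
apply: filterS => w Qw i; exact: Qw (choice.pickleK i).
Qed.

(** The intersection of measurable supersets whose probabilities approach the
    outer probability of X; a superset of X cannot cut off a part of positive
    probability from it. *)
Lemma measurable_hull (X : set Omega) : exists H, [/\ measurable H, X `<=` H &
  forall M, measurable M -> X `<=` M -> {ae P, forall w, H w -> M w}].
Proof.
pose S : set (\bar R) := [set P M | M in [set M | measurable M /\ X `<=` M]].
have SE M : measurable M -> X `<=` M -> (ereal_inf S <= P M)%E.
  by move=> mM XM; apply: ereal_inf_lbound; exists M.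
have Sfin : ereal_inf S \is a fin_num.
  rewrite ge0_fin_numE; last by apply: le_ereal_inf_tmp => _ [M _ <-].
  by rewrite (le_lt_trans (SE setT measurableT _))// probability_setT ltry.
have /choice[M MP] : forall n, exists M, [/\ measurable M, X `<=` M &
    (P M < ereal_inf S + (tol n)%:E)%E].
  move=> n; have [_ [M [mM XM] <-] PM] := lb_ereal_inf_adherent (tol_gt0 n) Sfin.
  by exists M.
have mM n : measurable (M n) by have [] := MP n.
have mH : measurable (\bigcap_n M n) by exact: bigcapT_measurable.
have XH : X `<=` \bigcap_n M n.
  by move=> w Xw n _; have [_ XM _] := MP n; exact: XM.
exists (\bigcap_n M n); split => // M' mM' XM'.
have PH : (P (\bigcap_n M n) <= ereal_inf S)%E.
  apply/lee_addgt0Pr => e /tol_lt[n ne]; have [_ _ PM] := MP n.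
  rewrite (@le_trans _ _ (P (M n)))//; first by rewrite le_measure ?inE//; exact: bigcap_inf.
  by rewrite (le_trans (ltW PM))// leeD2l// lee_fin ltW.
exists (\bigcap_n M n `\` M'); split.
- exact: measurableD.
- have /SE : measurable (\bigcap_n M n `&` M') by exact: measurableI.
  move=> /(_ (fun w Xw => conj (XH w Xw) (XM' w Xw))) h.
  have mHM : measurable (\bigcap_n M n `&` M') by exact: measurableI.
  apply/eqP; rewrite -measure_le0 -(leeD2rE _ _ (fin_num_measure P _ mHM)) add0e.
  by rewrite -measureDI//; exact: le_trans h.
- by move=> w /= /not_implyP[].
Qed.

Lemma complete_cauchy_seq (x : nat -> E) :
  (forall e : R, 0 < e -> exists N, forall m n, (N <= m)%N -> (N <= n)%N ->
     mdist (x m) (x n) < e) ->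
  exists z, forall e, 0 < e -> exists n, forall m, (n <= m)%N -> mdist z (x m) < e.
Proof.
move=> xC; have xc : cvg (x @ \oo).
  apply: (cauchy_cvg (T := E)); apply/cauchy_ballP => e /xC[N NP].
  exists ([set y | exists2 m, (N <= m)%N & y = x m],
          [set y | exists2 m, (N <= m)%N & y = x m]).
    by split; exists N => // m /= Nm; exists m.
  by move=> [_ _] [[m Nm ->] [n Nn ->]] /=; rewrite ballEmdist; exact: NP.
exists (lim (x @ \oo)) => e e0.
have /metricType_numDomainType.cvgr_dist_lt/(_ _ e0)[N _ NP] := xc.
by exists N => m /NP.
Qed.

Let agree (s : seq nat) (t : nat -> nat) :=
  forall i, (i < size s)%N -> t i = nth 0 s i.

(** The measurable projection theorem, up to null sets. For a finite sequence
    s let X s be the projection of the part of the set that is witnessed by the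
    sequences extending s, and H s a measurable hull of X s. As X s is the union
    of the sets X (rcons s k), almost every point of H s lies in some
    H (rcons s k). Hence outside a null set, a point w of H [::] can be followed
    along a branch sg with w in H of each of its prefixes. Such a w belongs to
    the cells of sg in Omega, because hulls do not exceed measurable supersets.
    The sets X of the prefixes are not empty, which gives points of E in the
    first cells of sg; the cells being thin, these points form a Cauchy sequence,
    and its limit x lies in every cell of sg. So (x, w) is in the set. *)
Lemma scheme_projection (K : @scheme R E d Omega) :
  exists2 F, measurable F &
    F `<=` [set w | exists x, scheme_set K (x, w)] /\
    {ae P, forall w, (exists x, scheme_set K (x, w)) -> F w}.
Proof.
pose X s := [set w | exists2 t, agree s t &
  exists x, forall n, cellE K n t x /\ cellO K n t w].
have /choice[H HP] := fun s => measurable_hull (X s).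
have mH s : measurable (H s) by case: (HP s).
have XH s : X s `<=` H s by case: (HP s).
have HM s M : measurable M -> X s `<=` M -> {ae P, forall w, H s w -> M w}.
  by case: (HP s) => _ _; apply.
pose loc s n := forall t, agree s t -> cellO K n t = cellO K n (nth 0 s).
have : {ae P, forall w s, [/\ H s w -> exists k, H (rcons s k) w,
    H s w -> X s !=set0 &
    forall n, loc s n -> H s w -> cellO K n (nth 0 s) w]}.
  apply: ae_forall_count => s.
  (* Each of the three claims compares H s with a measurable superset of X s. *)
  have h1 : {ae P, forall w, H s w -> exists k, H (rcons s k) w}.
    have : {ae P, forall w, H s w -> (\bigcup_k H (rcons s k)) w}.
      apply: HM; first exact: bigcup_measurable.
      move=> w [t st xt]; exists (t (size s)) => //; apply: XH; exists t => // i.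
      rewrite size_rcons ltnS leq_eqVlt => /predU1P[->|si].
        by rewrite nth_rcons ltnn eqxx.
      by rewrite nth_rcons si; exact: st.
    by apply: filterS => w Hw /Hw[k _]; exists k.
  have h2 : {ae P, forall w, H s w -> X s !=set0}.
    have [X0|/set0P X0] := eqVneq (X s) set0; last by apply: aeW => w _.
    have : {ae P, forall w, H s w -> set0 w} by apply: HM => //; rewrite X0.
    by apply: filterS => w /[apply].
  have h3 : {ae P, forall w, forall n, loc s n -> H s w -> cellO K n (nth 0 s) w}.
    apply: ae_foralln => n; have [ln|ln] := pselect (loc s n); last first.
      by apply: aeW => w /ln.
    have : {ae P, forall w, H s w -> cellO K n (nth 0 s) w}.
      apply: HM; first exact: cellO_measurable.
      by move=> w [t st [x xt]]; rewrite -(ln _ st); case: (xt n).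
    by apply: filterS => w ? _.
  by apply: filterS3 h1 h2 h3 => w.
move=> [N [mN N0 NP]]; exists (H [::] `\` N); first exact: measurableD.
split=> [w [Hw /(contra_not (@NP w))/contrapT wP]|]; last first.
  exists N; split => // w /= /not_implyP[[x [t xt]]] /not_andP[|/contrapT//].
  by move=> h; exfalso; apply: h; apply: XH; exists t => //; exists x.
have /choice[g gP] : forall s, exists k, H s w -> H (rcons s k) w.
  move=> s; have [Hs|] := pselect (H s w); last by exists 0%N.
  by have [/(_ Hs)[k ?] _ _] := wP s; exists k.
pose u := fix u k := if k is k'.+1 then rcons (u k') (g (u k')) else [::].
pose sg k := g (u k).
have uH k : H (u k) w by elim: k => [//|k IH]; exact: gP.
have su k : size (u k) = k by elim: k => [//|k IH]; rewrite /= size_rcons IH.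
have nu k i : (i < k)%N -> nth 0%N (u k) i = sg i.
  elim: k => // k IH; rewrite ltnS leq_eqVlt /= nth_rcons su => /predU1P[->|ik].
    by rewrite ltnn eqxx.
  by rewrite ik IH.
have sgO n : cellO K n sg w.
  have [k kP] := cell_local K n sg.
  have uE t : agree (u k) t -> cellO K n t = cellO K n sg.
    by move=> ut; apply: (kP _ _).2 => i ik; rewrite ut ?su// nu.
  rewrite -(uE (nth 0%N (u k)))//.
  have [_ _] := wP (u k); apply => // t ut.
  by rewrite uE// uE.
have /choice[x /choice[t xt]] : forall k, exists x, exists t,
    agree (u k) t /\ forall n, cellE K n t x.
  move=> k; have [_ /(_ (uH k))[w' [t ut [x xt]]] _] := wP (u k).
  by exists x, t; split => // n; case: (xt n).
have xE n : exists k, forall m, (k <= m)%N -> cellE K n sg (x m).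
  have [k kP] := cell_local K n sg; exists k => m km; have [ut xn] := xt m.
  rewrite -(kP (t m) _).1 // => i ik; rewrite ut ?su ?nu//; exact: leq_trans km.
have [|z zP] := @complete_cauchy_seq x.
  move=> e /(cellE_thin K sg)[n nP]; have [k kP] := xE n.
  by exists k => m m' km km'; apply: nP; exact: kP.
exists z, sg => n; split => //=.
have /closed_mdistP : closed (cellE K n sg) by exact: cellE_closed.
apply => e e0.
have [k kP] := xE n; have [k' k'P] := zP _ e0.
by exists (x (maxn k k')); [apply: kP; exact: leq_maxl|apply: k'P; exact: leq_maxr].
Qed.

End projection_theorem.

(** * Random compact sets *)

Section measurable_predicates.
Context {d : measure_display} {Omega : measurableType d}.

Lemma measurable_ex (Q : nat -> Omega -> Prop) :
  (forall k, measurable [set w | Q k w]) -> measurable [set w | exists k, Q k w].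
Proof.
move=> mQ; rewrite (_ : [set _ | _] = \bigcup_k [set w | Q k w]).
  exact: bigcupT_measurable.
by apply/seteqP; split=> [w [k ?]|w [k _ ?]]; exists k.
Qed.

Lemma measurable_all (Q : nat -> Omega -> Prop) :
  (forall k, measurable [set w | Q k w]) -> measurable [set w | forall k, Q k w].
Proof.
move=> mQ; rewrite (_ : [set _ | _] = \bigcap_k [set w | Q k w]).
  exact: bigcapT_measurable.
by apply/seteqP; split=> [w Qw k _|w Qw k] //; exact: Qw.
Qed.

Lemma measurable_and (Q Q' : Omega -> Prop) : measurable [set w | Q w] ->
  measurable [set w | Q' w] -> measurable [set w | Q w /\ Q' w].
Proof. exact: measurableI. Qed.

Lemma measurable_imp (p : Prop) (Q : Omega -> Prop) :
  (p -> measurable [set w | Q w]) -> measurable [set w | p -> Q w].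
Proof.
have [hp /(_ hp)|hp _] := pselect p.
  by congr measurable; apply/seteqP; split=> w //= h; exact: h.
by rewrite (_ : [set _ | _] = setT)//; apply/seteqP; split=> w // _ /hp.
Qed.

Lemma measurable_guard (p : Prop) (Q : Omega -> Prop) :
  (p -> measurable [set w | Q w]) -> measurable [set w | p /\ Q w].
Proof.
have [hp /(_ hp)|hp _] := pselect p.
  by congr measurable; apply/seteqP; split=> w //= [].
by rewrite (_ : [set _ | _] = set0)//; apply/seteqP; split=> w // [/hp].
Qed.

End measurable_predicates.

Section rcompact.
Context {R : realType} {E : completeMetricType R}.
Context {d : measure_display} {Omega : measurableType d}.
Variable P : probability Omega R.
Variable q : nat -> E.
Hypothesis q_dense : forall x (e : R), 0 < e -> exists k, mdist x (q k) < e.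

(** The second condition says that the distance to the set is a random
    variable; [compact_random_setP] makes this precise. *)
Definition rcompact (A : Omega -> set E) :=
  (forall w, compact (A w)) /\
  (forall x r, measurable [set w | hits (A w) x r]).

Lemma compact_random_setP (A : Omega -> set E) :
  compact_random_set [set p | A p.2 p.1] <-> rcompact A.
Proof.
have yA w : ysection [set p | A p.2 p.1] w = A w.
  by apply/seteqP; split=> [x /ysectionP|x Ax]//; apply/ysectionP.
split=> -[cA mA]; split=> [w|x]; first by rewrite -yA.
- move=> r.
  rewrite (_ : [set _ | _] = setT `&`
    [set w | (point_dist x (ysection [set p | A p.2 p.1] w) < r%:E)%E]).
    exact: emeasurable_fun_infty_o.
  by rewrite setTI; apply/seteqP; split=> w /=; rewrite yA => /point_dist_lt.
- by rewrite yA.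
- apply: measurability; first exact: (ErealGenInftyO.measurableE R).
  move=> _ [_ [r ->] <-]; rewrite setTI.
  rewrite (_ : _ @^-1` _ = [set w | hits (A w) x r])//.
  by apply/seteqP; split=> w /=; rewrite in_itv/= yA => /point_dist_lt.
Qed.

(** * Measurability tests along a dense sequence *)

Lemma q_dense_open (V : E -> Prop) x :
  (exists2 e : R, 0 < e & forall y, mdist x y < e -> V y) -> exists k, V (q k).
Proof. by move=> [e /(q_dense x)[k xk]] /(_ _ xk); exists k. Qed.

Definition random_point (g : Omega -> E) :=
  forall y r, measurable [set w | mdist y (g w) < r].

Lemma random_point_cst x : random_point (fun=> x).
Proof.
move=> y r; rewrite (_ : [set _ | _] = [set w | mdist y x < r /\ setT w]).
  by apply: measurable_guard => _; exact: measurableT.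
by apply/seteqP; split=> w //= [].
Qed.

(** The moving centre g w is replaced by a nearby term of the dense
    sequence, at the cost of shrinking the radius. *)
Lemma measurable_hits_random_point (A : Omega -> set E) g r :
  (forall x r, measurable [set w | hits (A w) x r]) -> random_point g ->
  measurable [set w | hits (A w) (g w) r].
Proof.
move=> mA mg; rewrite (_ : [set _ | _] = [set w | exists k n,
    mdist (q k) (g w) < tol n /\ hits (A w) (q k) (r - tol n)]).
  apply: measurable_ex => k; apply: measurable_ex => n; apply: measurable_and.
    exact: mg.
  exact: mA.
apply/seteqP; split=> w /= [].
  move=> a Aa ga; have : 0 < (r - mdist (g w) a) / 2 by rewrite divr_gt0// subr_gt0.
  move=> /tol_lt[n]; have [k gk] := q_dense (g w) (tol_gt0 n).
  rewrite ltr_pdivlMr// => ne; exists k, n; split; first by rewrite metric_sym.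
  exists a => //; have := metric_triangle (q k) (g w) a.
  rewrite (metric_sym (q k) (g w)).
  by move: gk ne; move: (tol n) => t; lra.
move=> k [n [gk /(hits_shift _)]]; rewrite metric_sym in gk => /(_ _ _ gk).
by rewrite subrK.
Qed.

(** A decreasing sequence of open neighbourhoods V n of the random set Z which
    shrinks to Z so that any choice of points in V n clusters in Z. It is the
    form of compactness which is compatible with measurability: conditions on Z
    become conditions on the V n, which are open and can therefore be tested on
    the dense sequence q, so that no measurable selection is needed. *)
Record shrinking (V : nat -> E -> Omega -> Prop) (Z : Omega -> set E) : Prop := {
  sh_meas : forall n k, measurable [set w | V n (q k) w];
  sh_open : forall n x w, V n x w ->
    exists2 e : R, 0 < e & forall y, mdist x y < e -> V n y w;
  sh_dec : forall n x w, V n.+1 x w -> V n x w;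
  sh_sup : forall n x w, Z w x -> V n x w;
  sh_lim : forall w u, (forall n, V n (u n) w) ->
    exists2 z, Z w z & cluster_point u z }.

Lemma rcompact_shrinking A : rcompact A ->
  shrinking (fun n x w => hits (A w) x (tol n)) A.
Proof.
move=> [cA mA]; split=> [n k|n x w|n x w|n x w Ax|w u uA].
- exact: mA.
- exact: hits_open.
- by apply: hitsW; exact: tol_le.
- by exists x; rewrite ?mdistxx ?tol_gt0.
- exact: compact_hits_cluster.
Qed.

(** By openness every point of Z yields points of the dense sequence in each
    V n, and conversely such points cluster in Z. *)
Lemma shrinking_nonempty V Z : shrinking V Z -> measurable [set w | Z w !=set0].
Proof.
move=> sV; rewrite (_ : [set _ | _] = [set w | forall n, exists k, V n (q k) w]).
  by apply: measurable_all => n; apply: measurable_ex => k; exact: sh_meas sV _ _.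
apply/seteqP; split=> w /=.
  move=> [z Zz] n; apply: (@q_dense_open (V n ^~ w)).
  exact: sh_open sV _ _ _ (sh_sup sV n Zz).
by move=> /choice[u /(sh_lim sV (w := w) (u := q \o u))[z Zz _]]; exists z.
Qed.

Definition random_map (f : Omega -> E -> E) :=
  (forall w, continuous (f w)) /\ forall x, random_point (f ^~ x).

Lemma random_map_id : random_map (fun=> id).
Proof. by split=> // [w x|]; [exact: cvg_id|exact: random_point_cst]. Qed.

(** Cutting Z by the preimage of a closed ball keeps it shrinking, provided that
    the radius of the ball is enlarged a little in the neighbourhoods. *)
Lemma shrinking_ball V Z f x r : shrinking V Z -> random_map f ->
  shrinking (fun n y w => V n y w /\ mdist x (f w y) < r + tol n)
            (fun w => [set z | Z w z /\ mdist x (f w z) <= r]).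
Proof.
move=> sV [cf mf]; split=> [n k|n y w|n y w|n y w|w u].
- by apply: measurable_and; [exact: sh_meas sV _ _|exact: mf].
- move=> [/(sh_open sV)[e e0 eV] xy].
  have gap : 0 < r + tol n - mdist x (f w y) by rewrite subr_gt0.
  have /(continuous_mdistP _).1/(_ y _ gap)[e' e'0 fe] := cf w.
  exists (Num.min e e'); first by rewrite lt_min e0.
  move=> z; rewrite lt_min => /andP[/eV Vz /fe h]; split => //.
  rewrite (le_lt_trans (metric_triangle x (f w y) (f w z)))// addrC.
  by rewrite -ltrBrDr.
- move=> [/(sh_dec sV)Vy xy]; split => //; rewrite (lt_le_trans xy)// lerD2l.
  exact: tol_le.
- move=> [Zy xy]; split; first exact: sh_sup sV _ _ _ Zy.
  by rewrite (le_lt_trans xy)// ltrDl tol_gt0.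
- move=> uV; have [n|z Zz uz] := sh_lim sV (w := w) (u := u).
    by have [] := uV n.
  exists z => //; split => //; apply/ler_addgt0Pr => e e0.
  have e20 : 0 < e / 2 by rewrite divr_gt0.
  have [m me] := tol_lt e20.
  have [n mn fzn] := cluster_point_cont (cf w) uz m e20.
  have [_ xn] := uV n; have := tol_le (R := R) mn.
  have := metric_triangle x (f w (u n)) (f w z).
  rewrite (metric_sym (f w (u n))) => h1 h2; move: h1 h2 me xn fzn => /=.
  by move: (tol n) (tol m) => a b; lra.
Qed.

Lemma shrinking_image_hits V Z f x r : shrinking V Z -> random_map f ->
  measurable [set w | hits (f w @` Z w) x r].
Proof.
move=> sV mf; rewrite (_ : [set _ | _] = [set w | exists n,
    [set z | Z w z /\ mdist x (f w z) <= r - tol n] !=set0]).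
  by apply: measurable_ex => n; exact: shrinking_nonempty (shrinking_ball _ _ sV mf).
apply/seteqP; split=> w /= [].
  move=> _ [z Zz <-] xz; have /tol_lt[n ne] : 0 < r - mdist x (f w z).
    by rewrite subr_gt0.
  by exists n, z; split => //; rewrite lerBrDl -lerBrDr ltW.
move=> n [z [Zz xz]]; exists (f w z); first by exists z.
by rewrite (le_lt_trans xz)// ltrBlDr ltrDl tol_gt0.
Qed.

Lemma shrinking_rcompact V Z : shrinking V Z -> (forall w, compact (Z w)) ->
  rcompact Z.
Proof.
move=> sV cZ; split=> // x r.
rewrite (_ : [set _ | _] = [set w | hits ((fun=> id) w @` Z w) x r]).
  exact: shrinking_image_hits sV random_map_id.
by apply/seteqP; split=> w /=; rewrite image_id.
Qed.

Lemma rcompact_image A f : rcompact A -> random_map f ->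
  rcompact (fun w => f w @` A w).
Proof.
move=> cA mf; split=> [w|x r].
  apply: continuous_compact; last by case: cA.
  by apply: continuous_subspaceT; case: mf.
exact: shrinking_image_hits (rcompact_shrinking cA) mf.
Qed.

(** A property that holds near Z at each w holds on V n for n large, where n
    depends on w. The bad events decrease to the empty set, so a single n is
    good enough up to a small probability. *)
Lemma shrinking_unif V Z (O : E -> Omega -> Prop) : shrinking V Z ->
  (forall k, measurable [set w | O (q k) w]) ->
  (forall w z, Z w z -> exists2 e : R, 0 < e & forall y, mdist z y < e -> O y w) ->
  forall eta : R, 0 < eta -> exists n, exists2 M, measurable M /\ (P M < eta%:E)%E &
    forall w, ~ M w -> forall k, V n (q k) w -> O (q k) w.
Proof.
move=> sV mO ZO eta eta0.
pose M n := [set w | exists k, V n (q k) w /\ ~ O (q k) w].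
have mM n : measurable (M n).
  apply: measurable_ex => k; apply: measurable_and; first exact: sh_meas sV _ _.
  by apply: measurableC; exact: mO.
have M0 : \bigcap_n M n = set0.
  apply/seteqP; split=> // w Mw.
  have /choice[u uP] : forall n, exists k, V n (q k) w /\ ~ O (q k) w.
    by move=> n; exact: Mw n I.
  have [n|z Zz uz] := sh_lim sV (w := w) (u := q \o u); first by have [] := uP n.
  have [e e0 eO] := ZO w z Zz; have [n _ zn] := uz e 0%N e0.
  by have [_] := uP n; apply; exact: eO.
have Mcvg : P \o M @ \oo --> 0%E.
  rewrite -(measure0 P) -M0; apply: nonincreasing_cvg_mu => //.
  - by rewrite -ge0_fin_numE// fin_num_measure.
  - exact: bigcapT_measurable.
  - apply/nonincreasing_seqP => n; apply/subsetPset => w [k [Vk Ok]].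
    by exists k; split => //; exact: sh_dec sV _ _ _ Vk.
have /Mcvg[n _ /(_ n (leqnn n))/= Pn] : nbhs (0%E : \bar R) [set x | (x < eta%:E)%E].
  by apply: open_ereal_lt'; rewrite lte_fin.
exists n, (M n) => // w Mw k Vk.
by apply: contrapT => Ok; apply: Mw; exists k.
Qed.

(** Uniform continuity of a random map near a compact set, in probability: for
    one n, points of V n have images close to the image of Z. With the identity
    map this says that V n is contained in a small neighbourhood of Z. *)
Lemma shrinking_near V Z f : shrinking V Z -> random_map f ->
  forall e eta : R, 0 < e -> 0 < eta ->
  exists n, exists2 M, measurable M /\ (P M < eta%:E)%E &
    forall w, ~ M w -> forall x, V n x w -> hits (f w @` Z w) (f w x) e.
Proof.
move=> sV mf e eta e0 eta0; have e20 : 0 < e / 2 by rewrite divr_gt0.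
have [k|w z Zz|n [M mM MP]] := @shrinking_unif V Z
  (fun x w => hits (f w @` Z w) (f w x) (e / 2)) sV _ _ _ eta0.
- apply: measurable_hits_random_point; last by case: mf => _; apply.
  by move=> x r; exact: shrinking_image_hits sV mf.
- have /(continuous_mdistP _).1/(_ z _ e20)[e' e'0 fe] := mf.1 w.
  exists e' => // y /fe zy; exists (f w z); first by exists z.
  by rewrite metric_sym.
exists n, M => // w Mw x Vx.
have [e1 e10 eV] := sh_open sV Vx.
have /(continuous_mdistP _).1/(_ x _ e20)[e' e'0 fe] := mf.1 w.
have [|k xk] := q_dense x (e := Num.min e1 e'); first by rewrite lt_min e10.
move: xk; rewrite lt_min => /andP[/eV Vk /fe xk].
by rewrite (splitr e); apply: hits_shift xk _; exact: MP.
Qed.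

Lemma common_radius (V : nat -> E -> Prop) n x :
  (forall k, (k <= n)%N -> exists2 e : R, 0 < e & forall y, mdist x y < e -> V k y) ->
  exists2 e : R, 0 < e & forall y, mdist x y < e -> forall k, (k <= n)%N -> V k y.
Proof.
elim: n => [|n IH] h.
  have [e e0 eV] := h 0%N (leqnn _); exists e => // y /eV Vy k.
  by rewrite leqn0 => /eqP ->.
have [k kn|e e0 eV] := IH; first by apply: h; exact: leqW.
have [e' e'0 e'V] := h n.+1 (leqnn _).
exists (Num.min e e'); first by rewrite lt_min e0.
move=> y; rewrite lt_min => /andP[/eV h1 /e'V h2] k.
by rewrite leq_eqVlt => /predU1P[->//|]; rewrite ltnS; exact: h1.
Qed.

(** With identity maps f k this is the intersection of A and all B k; with a
    constant family it is the intersection of A with a preimage. These two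
    cases give the stability under intersections and one half of the invariance
    of the minimal attractor. *)
Definition constrained (A : Omega -> set E) (f : nat -> Omega -> E -> E)
    (B : nat -> Omega -> set E) : Omega -> set E :=
  fun w => A w `&` [set x | forall k, B k w (f k w x)].

Definition nearly_constrained (A : Omega -> set E) (f : nat -> Omega -> E -> E)
    (B : nat -> Omega -> set E) n x w :=
  hits (A w) x (tol n) /\
  forall k, (k <= n)%N -> hits (B k w) (f k w x) (tol n).

Lemma constrained_shrinking A f B : rcompact A ->
  (forall k, random_map (f k)) -> (forall k, rcompact (B k)) ->
  shrinking (nearly_constrained A f B) (constrained A f B).
Proof.
move=> cA mf cB; split=> [n k|n x w|n x w|n x w|w u].
- apply: measurable_and; first by case: cA.
  apply: measurable_all => i; apply: measurable_imp => _.
  by apply: measurable_hits_random_point; [case: (cB i)|case: (mf i)].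
- move=> [/hits_open[e e0 eA] xB].
  have [k kn|e' e'0 e'B] := @common_radius
      (fun k y => hits (B k w) (f k w y) (tol n)) n x.
    have [e1 e10 eB] := hits_open (xB k kn).
    have /(continuous_mdistP _).1/(_ x _ e10)[e' e'0 fe] := (mf k).1 w.
    by exists e' => // y /fe/eB.
  exists (Num.min e e'); first by rewrite lt_min e0.
  by move=> y; rewrite lt_min => /andP[/eA h1 /e'B h2]; split.
- move=> [xA xB]; have nn := tol_le (R := R) (leqnSn n).
  by split; [exact: hitsW xA|move=> k kn; apply: hitsW (xB k (leqW kn))].
- move=> [Ax Bx]; split; first by exists x; rewrite ?mdistxx ?tol_gt0.
  by move=> k _; exists (f k w x); rewrite ?mdistxx ?tol_gt0.
- move=> uV; have [n|z Az uz] := compact_hits_cluster (cA.1 w) (u := u).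
    by have [] := uV n.
  exists z => //; split => // k.
  apply: (@cluster_hits _ _ k _ (f k w \o u)).
  + by apply: compact_closed_mdist; case: (cB k).
  + by move=> n kn; have [_] := uV n; apply.
  + by apply: cluster_point_cont => //; case: (mf k).
Qed.

Lemma constrained_rcompact A f B : rcompact A ->
  (forall k, random_map (f k)) -> (forall k, rcompact (B k)) ->
  rcompact (constrained A f B).
Proof.
move=> cA mf cB; apply: shrinking_rcompact; first exact: constrained_shrinking.
move=> w; apply: (@subclosed_compact _ _ (A w)); last 2 first.
  by case: cA.
  by move=> x [].
apply: closedI; first by apply: compact_closed_mdist; case: cA.
rewrite (_ : [set _ | _] = \bigcap_k (f k w @^-1` (B k w))); last first.
  by apply/seteqP; split=> x Bx k //; [move=> _|]; exact: Bx.
apply: closed_bigI => k _; apply: closed_comp.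
  by move=> x _; case: (mf k) => + _; apply.
by apply: compact_closed_mdist; case: (cB k).
Qed.

(** * Measurable sets with compact sections *)

(** Measurability in the product makes the events that K meets a ball
    projections of measurable sets, hence measurable up to null sets. Countably
    many balls suffice, and emptying the set on the union of the countably many
    exceptional null sets makes all these events measurable. *)
Lemma measurable_compact_rcompact (K : set (E * Omega)) : random_set K ->
  {ae P, forall w, compact (ysection K w)} ->
  exists2 A, rcompact A & {ae P, forall w, A w = ysection K w}.
Proof.
move=> mK cK.
have hG k n : exists G, [/\ measurable G,
    G `<=` [set w | hits (ysection K w) (q k) (tol n)] &
    {ae P, forall w, hits (ysection K w) (q k) (tol n) -> G w}].
  pose S : set (E * Omega) := K `&` ([set x | mdist (q k) x < tol n] `*` setT).
  have Sw w : (exists x, S (x, w)) <-> hits (ysection K w) (q k) (tol n).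
    split=> [[x [Kx [/= qx _]]]|[x /ysectionP Kx qx]].
      by exists x => //; apply/ysectionP.
    by exists x; split.
  have [C SC] : souslin S.
    apply: (measurable_souslin q_dense); apply: measurableI => //.
    apply: measurableX => //; apply: sub_sigma_algebra.
    exact: open_mdist_lt.
  have [G mG [GS SG]] := scheme_projection P C; rewrite -SC in GS SG.
  exists G; split => // [w /GS /Sw//|].
  by apply: filterS SG => w h /Sw; exact: h.
have /choice[F FP] : forall k, exists F : nat -> set Omega, forall n,
    [/\ measurable (F n),
       F n `<=` [set w | hits (ysection K w) (q k) (tol n)] &
       {ae P, forall w, hits (ysection K w) (q k) (tol n) -> F n w}].
  by move=> k; have /choice[F FP] := hG k; exists F.
have mF k n : measurable (F k n) by have [] := FP k n.
have : {ae P, forall w, compact (ysection K w) /\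
    forall k n, hits (ysection K w) (q k) (tol n) -> F k n w}.
  apply: filterI => //; apply: ae_foralln => k; apply: ae_foralln => n.
  by have [] := FP k n.
move=> [N [mN N0 NP]].
have {}NP w : ~ N w -> compact (ysection K w) /\
    forall k n, hits (ysection K w) (q k) (tol n) -> F k n w.
  by move=> /(contra_not (@NP w))/contrapT.
exists (fun w => [set x | ~ N w /\ ysection K w x]); last first.
  exists N; split => // w /= h; apply: contrapT => Nw; apply: h.
  by apply/seteqP; split=> x //= [].
split=> [w|x r].
  have [Nw|Nw] := pselect (N w).
    rewrite (_ : [set _ | _] = set0); first exact: compact0.
    by apply/seteqP; split=> x // [/(_ Nw)].
  rewrite (_ : [set _ | _] = ysection K w); first by have [] := NP w Nw.
  by apply/seteqP; split=> x // [].
rewrite (_ : [set _ | _] = [set w | (~` N) w /\ exists k n,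
    mdist x (q k) < r - tol n /\ F k n w]).
  apply: measurable_and; first exact: measurableC.
  apply: measurable_ex => k; apply: measurable_ex => n.
  by apply: measurable_guard => _; exact: mF.
apply/seteqP; split=> w /=.
  move=> [a [Nw Ka] xa]; split => //.
  have : 0 < (r - mdist x a) / 2 by rewrite divr_gt0// subr_gt0.
  move=> /tol_lt[n]; have [k gk] := q_dense a (tol_gt0 n).
  rewrite ltr_pdivlMr// => ne; exists k, n; split.
    have := metric_triangle x a (q k).
    by move: gk ne; move: (tol n) => ?; lra.
  by apply: (NP w Nw).2; exists a => //; rewrite metric_sym.
move=> [Nw [k [n [xk kF]]]]; have [_ /(_ _ kF) kK _] := FP k n.
have [a Ka xa] := hits_shift xk kK.
by exists a => //; move: xa; rewrite addrC subrK.
Qed.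

End rcompact.

(** * Essential minima of families of random compact sets *)

Section essential.
Context {R : realType} {E : completeMetricType R}.
Context {d : measure_display} {Omega : measurableType d}.
Variable P : probability Omega R.
Variable q : nat -> E.
Hypothesis q_dense : forall x (e : R), 0 < e -> exists k, mdist x (q k) < e.

Lemma near_maximum (T : Type) (S : set T) (f : T -> R) (c e : R) :
  S !=set0 -> (forall x, S x -> f x <= c) -> 0 < e ->
  exists2 x, S x & forall y, S y -> f y <= f x + e.
Proof.
move=> [x0 Sx0] fc e0.
have fS : has_sup [set f x | x in S].
  by split; [exists (f x0); exists x0|exists c => _ [x Sx <-]; exact: fc].
have [_ [x Sx <-] xe] := sup_adherent e0 fS; exists x => // y Sy.
rewrite -lerBlDr (le_trans _ (ltW xe))// lerD2r.
by apply: ub_le_sup; [case: fS|exists y].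
Qed.

Lemma near_minimum (T : Type) (S : set T) (f : T -> R) (c e : R) :
  S !=set0 -> (forall x, S x -> c <= f x) -> 0 < e ->
  exists2 x, S x & forall y, S y -> f x <= f y + e.
Proof.
move=> S0 cf e0.
have [x Sx|x Sx xP] := @near_maximum _ S (fun x => - f x) (- c) e S0 _ e0.
  by rewrite lerN2 cf.
by exists x => // y /xP; rewrite lerNl opprD opprK lerBlDr.
Qed.

Lemma ae_measure_le (X Y : set Omega) : measurable X -> measurable Y ->
  {ae P, forall w, X w -> Y w} -> (P X <= P Y)%E.
Proof.
move=> mX mY [N [mN N0 NP]]; rewrite -[leRHS]adde0 -N0.
apply: (@le_trans _ _ (P (Y `|` N))); last exact: measureU2.
apply: le_measure; rewrite ?inE//; first exact: measurableU.
move=> w Xw; have [Nw|Nw] := pselect (N w); [by right|left].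
by apply: contrapT => Yw; apply: Nw; apply: NP => /= /(_ Xw).
Qed.

Lemma ae_converse (X Y : set Omega) : measurable X -> measurable Y ->
  {ae P, forall w, X w -> Y w} -> (P Y <= P X)%E -> {ae P, forall w, Y w -> X w}.
Proof.
move=> mX mY XY YX; exists (Y `\` X); split.
- exact: measurableD.
- have mYX : measurable (Y `&` X) by exact: measurableI.
  apply/eqP; rewrite -measure_le0 -(leeD2rE _ _ (fin_num_measure P _ mYX)) add0e.
  rewrite -measureDI//; apply: le_trans YX _; apply: ae_measure_le => //.
  by apply: filterS XY => w XY Xw; split => //; exact: XY.
- by move=> w /= /not_implyP[].
Qed.

(** These countably many numbers separate nested random compact sets up to null
    events, by [ae_sub_hit_prob]. They play the role of a strictly monotone
    functional in the optimization arguments below. *)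
Definition hit_prob (A : Omega -> set E) k n : R :=
  fine (P [set w | hits (A w) (q k) (tol n)]).

Lemma hit_prob_ge0 A k n : 0 <= hit_prob A k n.
Proof. by rewrite fine_ge0. Qed.

Lemma hit_prob_le A B k n : rcompact A -> rcompact B ->
  {ae P, forall w, A w `<=` B w} -> hit_prob A k n <= hit_prob B k n.
Proof.
move=> [_ mA] [_ mB] AB; rewrite fine_le ?fin_num_measure//.
by apply: ae_measure_le => //; apply: filterS AB => w AB; exact: hitsS.
Qed.

Lemma hit_prob_le1 A k n : rcompact A -> hit_prob A k n <= 1.
Proof.
move=> [_ mA]; rewrite -[leRHS]/(fine (1%E : \bar R)) fine_le ?fin_num_measure//.
exact: probability_le1.
Qed.

(** Equality of the probabilities of nested events makes them equal almost
    surely, and a closed set that meets all the small balls met by another one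
    contains it. *)
Lemma ae_sub_hit_prob A B : rcompact A -> rcompact B ->
  {ae P, forall w, A w `<=` B w} ->
  (forall k n, hit_prob B k n <= hit_prob A k n) ->
  {ae P, forall w, B w `<=` A w}.
Proof.
move=> [cA mA] [cB mB] AB BA.
have : {ae P, forall w k n, hits (B w) (q k) (tol n) -> hits (A w) (q k) (tol n)}.
  apply: ae_foralln => k; apply: ae_foralln => n.
  apply: (@ae_converse [set w | hits (A w) (q k) (tol n)]
                       [set w | hits (B w) (q k) (tol n)]) => //.
    by apply: filterS AB => w AB; exact: hitsS.
  rewrite -(@fineK _ (P [set w | hits (B w) _ _])) ?fin_num_measure//.
  rewrite -(@fineK _ (P [set w | hits (A w) _ _])) ?fin_num_measure// lee_fin.
  exact: BA.
apply: filterS => w h x Bx.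
have /closed_mdistP := compact_closed_mdist (cA w); apply => e e0.
have [n ne] : exists n, tol n < e / 2 by apply: tol_lt; rewrite divr_gt0.
have [k xk] := q_dense x (tol_gt0 n).
have kA : hits (A w) (q k) (tol n).
  by apply: h; exists x => //; rewrite metric_sym.
apply: hitsW (hits_shift xk kA).
by move: ne; move: (tol n) => t; lra.
Qed.

Definition dec_triple m : nat * nat * nat := odflt (0, 0, 0)%N (choice.unpickle m).

Lemma dec_tripleK p : dec_triple (choice.pickle p) = p.
Proof. by rewrite /dec_triple choice.pickleK. Qed.

(** For each ball and each tolerance choose a member of the family whose
    probability of meeting the ball is nearly minimal. The intersection A of these
    countably many members attains all the minima; as its intersection with any
    other member C is still in the family, that intersection cannot have smaller
    hitting probabilities, and so A is almost surely contained in C. *)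
Lemma essential_minimum (CC : set (Omega -> set E)) : CC !=set0 ->
  (forall A, CC A -> rcompact A) ->
  (forall A : nat -> Omega -> set E, (forall k, CC (A k)) ->
    CC (fun w => \bigcap_k A k w)) ->
  exists2 A, CC A & forall C, CC C -> {ae P, forall w, A w `<=` C w}.
Proof.
move=> CC0 cCC CCI.
have /choice[C CP] : forall p : nat * nat * nat, exists C, CC C /\
    forall C', CC C' -> hit_prob C p.1.1 p.1.2 <= hit_prob C' p.1.1 p.1.2 + tol p.2.
  move=> p; have [x _|C CCC CP] := @near_minimum _ CC
    (fun C => hit_prob C p.1.1 p.1.2) 0 (tol p.2) CC0 _ (tol_gt0 _).
    exact: hit_prob_ge0.
  by exists C.
pose A w := \bigcap_m C (dec_triple m) w.
have CCA : CC A by apply: CCI => m; have [] := CP (dec_triple m).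
exists A => // D CCD.
(* The family with A at index 0 and D elsewhere has intersection A and D. *)
pose AD w := A w `&` D w.
have CCAD : CC AD.
  rewrite (_ : AD = fun w => \bigcap_k (if k is 0 then A else D) w).
    by apply: CCI => -[|k].
  apply/funext => w; apply/seteqP; split=> [x [Ax Dx] [|k] _//|x h].
  by split; [exact: (h 0%N I)|exact: (h 1%N I)].
have : {ae P, forall w, A w `<=` AD w}.
  apply: ae_sub_hit_prob; [exact: cCC|exact: cCC|by apply: aeW => w x []|].
  move=> k n; apply/ler_addgt0Pr => e /tol_lt[j je].
  rewrite (@le_trans _ _ (hit_prob AD k n + tol j))//; last by rewrite lerD2l ltW.
  have [CCC /(_ _ CCAD)/= CAD] := CP (k, n, j).
  rewrite (le_trans _ CAD)//; apply: hit_prob_le; [exact: cCC|exact: cCC|].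
  by apply: aeW => w x /(_ (choice.pickle (k, n, j)) I); rewrite dec_tripleK.
by apply: filterS => w h x /h[].
Qed.

(** The dual optimization: gather countably many countable subfamilies which
    nearly maximize the hitting probabilities of m. Enlarging their union BB1 by
    one element B stays within the countable subfamilies, so the hitting
    probabilities can no longer increase. *)
Lemma countable_subfamily (T : Type) (BB : set T) (m : set T -> Omega -> set E) :
  (forall D, D `<=` BB -> rcompact (m D)) ->
  (forall D D', D `<=` D' -> D' `<=` BB -> {ae P, forall w, m D w `<=` m D' w}) ->
  exists BB1, [/\ BB1 `<=` BB, countable BB1 &
    forall B, BB B -> {ae P, forall w, m (BB1 `|` [set B]) w `<=` m BB1 w}].
Proof.
move=> cm mm; pose S := [set D : set T | D `<=` BB /\ countable D].
have /choice[D DP] : forall p : nat * nat * nat, exists D, S D /\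
    forall D', S D' -> hit_prob (m D') p.1.1 p.1.2 <= hit_prob (m D) p.1.1 p.1.2 + tol p.2.
  move=> p; have [|x [xB _]|D SD DP] := @near_maximum _ S
    (fun D => hit_prob (m D) p.1.1 p.1.2) 1 (tol p.2) _ _ (tol_gt0 _).
    by exists set0; split.
    by apply: hit_prob_le1; exact: cm.
  by exists D.
pose BB1 := \bigcup_i D (dec_triple i).
have BB1B : BB1 `<=` BB by move=> B [i _]; have [[+ _] _] := DP (dec_triple i); apply.
have cBB1 : countable BB1.
  by apply: bigcup_countable => // i _; have [[]] := DP (dec_triple i).
exists BB1; split => // B BBB.
have BB1B' : BB1 `|` [set B] `<=` BB by move=> B' [/BB1B//|->].
apply: ae_sub_hit_prob; [exact: cm|exact: cm|by apply: mm => // ?; left|].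
move=> k n; apply/ler_addgt0Pr => e /tol_lt[j je].
rewrite (@le_trans _ _ (hit_prob (m BB1) k n + tol j))//; last by rewrite lerD2l ltW.
have [[DB _] /(_ (BB1 `|` [set B]))/= h] := DP (k, n, j).
apply: le_trans (h _) _.
  split => //; rewrite -bigcup2E; apply: bigcup_countable => // -[|[|i]] _ /=.
  - exact: cBB1.
  - exact: countable1.
  - exact: countable0.
rewrite lerD2r; apply: hit_prob_le; [exact: cm|exact: cm|].
apply: mm => // B' DB'; exists (choice.pickle (k, n, j)) => //.
by rewrite dec_tripleK.
Qed.

End essential.

(** * Attraction in probability *)

Section times.
Context {R : realType}.
Variables T1 T2 : set R.
Hypothesis hT : time_sets T1 T2.

Lemma time_sub t : T2 t -> T1 t.
Proof. by case: hT => _ _; apply. Qed.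

Lemma time1N t : T1 t -> T1 (- t).
Proof.
by case: hT => -[->//|->] _ _ [k _ <-]; exists (- k) => //; rewrite mulrNz.
Qed.

Lemma time2D s t : T2 s -> T2 t -> T2 (s + t).
Proof.
case: hT => _ + _ => -[->|->|->|->]//.
- exact: addr_ge0.
- by move=> [k _ <-] [l _ <-]; exists (k + l) => //; rewrite intrD.
- by move=> [k _ <-] [l _ <-]; exists (k + l)%N => //; rewrite natrD.
Qed.

Lemma time2B s t : T2 s -> T2 t -> t <= s -> T2 (s - t).
Proof.
case: hT => _ + _ => -[->|->|->|->]//.
- by move=> _ _ /=; rewrite subr_ge0.
- by move=> [k _ <-] [l _ <-] _; exists (k - l) => //; rewrite intrB.
- move=> [k _ <-] [l _ <-]; rewrite ler_nat => lk.
  by exists (k - l)%N => //; rewrite natrB.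
Qed.

Lemma measurable_time1 : measurable T1.
Proof.
case: hT => -[->//|->] _ _; apply: countable_measurable => //.
exact: (sub_countable (card_image_le _ _) (countableP _)).
Qed.

Lemma measurable_time2 : measurable T2.
Proof.
case: hT => _ + _ => -[->//|->|->|->].
- by rewrite -set_itvcy; exact: measurable_itv.
- apply: countable_measurable => //; exact: (sub_countable (card_image_le _ _) (countableP _)).
- apply: countable_measurable => //; exact: (sub_countable (card_image_le _ _) (countableP _)).
Qed.

End times.

Section vanishing.
Context {R : realType} {d : measure_display} {Omega : measurableType d}.
Variable P : probability Omega R.
Variable T2 : set R.

(** Convergence to 0 of the outer probability of the events S t, stated with
    measurable supersets so that no measurability of S t is required. *)
Definition vanish (S : R -> Omega -> Prop) :=
  forall eta : R, 0 < eta -> exists t0, forall t, T2 t -> t0 <= t ->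
    exists2 M, measurable M /\ (P M <= eta%:E)%E & forall w, S t w -> M w.

Lemma vanish_sub (S S' : R -> Omega -> Prop) :
  (forall t w, T2 t -> S t w -> S' t w) -> vanish S' -> vanish S.
Proof.
move=> SS' vS' eta /vS'[t0 h]; exists t0 => t T2t /(h _ T2t)[M mM S'M].
by exists M => // w /(SS' _ _ T2t)/S'M.
Qed.

Lemma vanish_or S S' : vanish S -> vanish S' ->
  vanish (fun t w => S t w \/ S' t w).
Proof.
move=> vS vS' eta eta0; have eta20 : 0 < eta / 2 by rewrite divr_gt0.
have [t1 h1] := vS _ eta20; have [t2 h2] := vS' _ eta20.
exists (Num.max t1 t2) => t T2t; rewrite ge_max => /andP[/(h1 _ T2t) + /(h2 _ T2t)].
move=> [M [mM PM] SM] [M' [mM' PM'] SM']; exists (M `|` M').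
  split; first exact: measurableU.
  by rewrite (le_trans (measureU2 _ _ _))// (splitr eta) EFinD leeD.
by move=> w [/SM|/SM']; [left|right].
Qed.

Lemma vanish_finite (S : nat -> R -> Omega -> Prop) n : (forall k, vanish (S k)) ->
  vanish (fun t w => exists2 k, (k <= n)%N & S k t w).
Proof.
move=> vS; elim: n => [|n IH].
  by apply: vanish_sub (vS 0%N) => t w _ [k]; rewrite leqn0 => /eqP ->.
apply: vanish_sub (vanish_or IH (vS n.+1)) => t w _ [k].
by rewrite leq_eqVlt ltnS => /predU1P[->|kn]; [right|left; exists k].
Qed.

Lemma cvg0_in_probabilityP (Y : R -> Omega -> \bar R) :
  cvg0_in_probability P T2 Y <->
  forall e : R, 0 < e -> vanish (fun t w => (e%:E <= Y t w)%E).
Proof.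
split=> [h e e0 eta eta0|h e e0].
  have /(h e e0)[t0 [_ t0P]] : nbhs (0%E : \bar R) [set x | (x < eta%:E)%E].
    by apply: open_ereal_lt'; rewrite lte_fin.
  exists (t0 + 1) => t T2t t0t.
  have /ereal_inf_lt[_ /= [M [mM YM] <-] PM] :
      (outer_prob P [set w | (e%:E <= Y t w)%E] < eta%:E)%E.
    by apply: t0P => //; rewrite (lt_le_trans _ t0t)// ltrDl.
  by exists M => //; split => //; exact: ltW.
move=> U /nbhs_EFin/nbhs_ballP[eta /= eta0 etaU].
have eta20 : 0 < eta / 2 by rewrite divr_gt0.
have [t0 t0P] := h e e0 _ eta20; exists t0; split; first exact: num_real.
move=> t /ltW t0t T2t /=; have [M [mM PM] YM] := t0P t T2t t0t.
set S := [set w | _].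
have S0 : (0 <= outer_prob P S)%E by apply: le_ereal_inf_tmp => _ [M' _ <-].
have SM : (outer_prob P S <= (eta / 2)%:E)%E.
  by apply: le_trans PM; apply: ereal_inf_lbound; exists M.
move: (outer_prob P S) S0 SM => [r| |]//; rewrite !lee_fin => r0 reta.
apply: etaU; rewrite /ball/= sub0r normrN ger0_norm//.
by rewrite (le_lt_trans reta)// ltr_pdivrMr// ltr_pMr// ltr1n.
Qed.

End vanishing.

(** * Attracting random compact sets of a random dynamical system *)

Section rds.
Context {R : realType} {E : completeMetricType R}.
Context {d : measure_display} {Omega : measurableType d}.
Variable P : probability Omega R.
Variable q : nat -> E.
Hypothesis q_dense : forall x (e : R), 0 < e -> exists k, mdist x (q k) < e.
Variables T1 T2 : set R.
Hypothesis hT : time_sets T1 T2.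
Variable theta : R -> Omega -> Omega.
Hypothesis htheta : metric_dynamical_system P T1 theta.
Variable phi : R -> Omega -> E -> E.
Hypothesis hphi : random_dynamical_system theta T2 phi.

Implicit Types (A : Omega -> set E) (B D : set (E * Omega)) (t s : R).

Lemma thetaD s t w : T1 s -> T1 t -> theta (s + t) w = theta s (theta t w).
Proof. by move=> T1s T1t; rewrite (mds_add htheta). Qed.

Lemma thetaK t w : T1 t -> theta (- t) (theta t w) = w.
Proof.
move=> T1t; rewrite -thetaD//; first by rewrite addNr (mds_0 htheta).
exact: time1N hT _ T1t.
Qed.

Lemma thetaNK t w : T1 t -> theta t (theta (- t) w) = w.
Proof.
move=> T1t; rewrite -thetaD//; first by rewrite subrr (mds_0 htheta).
exact: time1N hT _ T1t.
Qed.

Lemma measurable_theta t (M : set Omega) : T1 t -> measurable M ->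
  measurable [set w | M (theta t w)].
Proof.
move=> T1t mM; have mT1 : measurable (T1 `*` [set: Omega]).
  by apply: measurableX => //; exact: measurable_time1 hT.
have /(measurable_xsection t) := mds_measurable htheta mT1 mM.
congr measurable; apply/seteqP.
by split=> w /=; [move=> /xsectionP[]|move=> ?; apply/xsectionP].
Qed.

Lemma prob_theta t (M : set Omega) : T1 t -> measurable M ->
  P [set w | M (theta t w)] = P M.
Proof. by move=> T1t; exact: (mds_preserving htheta T1t). Qed.

Lemma ae_theta t (Q : Omega -> Prop) : T1 t ->
  {ae P, forall w, Q w} -> {ae P, forall w, Q (theta t w)}.
Proof.
move=> T1t [N [mN N0 NQ]]; exists [set w | N (theta t w)]; split.
- exact: measurable_theta.
- by rewrite prob_theta.
- by move=> w Qw; exact: NQ.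
Qed.

Lemma rcompact_theta t A : T1 t -> rcompact A -> rcompact (fun w => A (theta t w)).
Proof.
move=> T1t [cA mA]; split=> // x r.
exact: (@measurable_theta t [set w | hits (A w) x r]).
Qed.

Lemma random_map_phi t : T2 t -> random_map (phi t).
Proof.
move=> T2t; split=> [w|x y r]; first exact: (rds_continuous hphi).
pose U : set (borel E) := [set z : E | mdist y z < r].
have mU : measurable U by apply: sub_sigma_algebra; exact: open_mdist_lt.
have mT2 : measurable (T2 `*` [set: borel E] `*` [set: Omega]).
  apply: measurableX => //; apply: measurableX => //; exact: measurable_time2 hT.
have /(measurable_xsection (t, x : borel E)) := rds_measurable hphi mT2 mU.
congr measurable; apply/seteqP.
by split=> w /=; [move=> /xsectionP[]|move=> ?; apply/xsectionP].
Qed.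

Lemma phiD s t w x : T2 s -> T2 t -> phi (t + s) w x = phi t (theta s w) (phi s w x).
Proof. by move=> T2s T2t; rewrite (rds_cocycle hphi). Qed.

Local Notation vanish := (vanish P T2).

(** Since theta t preserves P, an event M of small probability may be discarded
    at the state theta t w, uniformly in t; this is how properties of a random
    set which hold outside M only are used along the dynamics. *)
Lemma vanish_up_to S :
  (forall eta : R, 0 < eta -> exists S' M, [/\ vanish S',
     measurable M, (P M < eta%:E)%E &
     forall t w, T2 t -> S t w -> S' t w \/ M (theta t w)]) ->
  vanish S.
Proof.
move=> h eta eta0; have eta20 : 0 < eta / 2 by rewrite divr_gt0.
have [S' [M [vS' mM PM SS']]] := h _ eta20; have [t0 t0P] := vS' _ eta20.
exists t0 => t T2t /(t0P _ T2t)[M' [mM' PM'] S'M'].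
have T1t := time_sub hT T2t.
exists (M' `|` [set w | M (theta t w)]).
  split; first by apply: measurableU => //; exact: measurable_theta.
  apply: le_trans (measureU2 _ _ _) _ => //; first exact: measurable_theta.
  rewrite (splitr eta) EFinD; apply: leeD => //.
  by have := ltW PM; rewrite -(prob_theta T1t mM).
by move=> w /(SS' _ _ T2t)[/S'M'|]; [left|right].
Qed.

Lemma vanish_shift t S : T2 t -> 0 <= t ->
  vanish S <-> vanish (fun s w => S (t + s) w).
Proof.
move=> T2t t0; split=> vS eta /vS[u uP].
  exists u => s T2s us; apply: uP; first exact: time2D hT _ _ T2t T2s.
  by rewrite (le_trans us)// lerDr.
(* Times below t are excluded so that s - t is again a time. *)
exists (Num.max t (t + u)) => s T2s; rewrite ge_max => /andP[ts tus].
have [||M mM SM] := uP (s - t).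
- exact: time2B hT _ _ T2s T2t ts.
- by rewrite lerBrDl.
by exists M => // w Sw; apply: SM; rewrite addrC subrK.
Qed.

(** Invariance of P turns pullback attraction into forward attraction. For
    almost sure convergence the two notions differ. *)
Lemma vanish_pullback S :
  vanish (fun t w => S t (theta (- t) w)) -> vanish S.
Proof.
move=> vS eta /vS[t0 t0P]; exists t0 => t T2t /(t0P _ T2t)[M [mM PM] SM].
have T1t := time_sub hT T2t.
exists [set w | M (theta t w)].
  by split; [exact: measurable_theta|rewrite prob_theta].
by move=> w Sw; apply: SM; rewrite thetaK.
Qed.

(** Forward attraction in probability; [attractsP] relates it to the
    semi-metric. *)
Definition attracts A B := forall e : R, 0 < e ->
  vanish (fun t w => exists2 b, ysection B w b &
                     ~ hits (A (theta t w)) (phi t w b) e).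

Lemma attractsP A B : attracts A B <->
  cvg0_in_probability P T2 (fun t w =>
    semi_dist (phi t w @` ysection B w) (A (theta t w))).
Proof.
split=> [h|/cvg0_in_probabilityP h].
  apply/cvg0_in_probabilityP => e e0; have e20 : 0 < e / 2 by rewrite divr_gt0.
  apply: vanish_sub (h _ e20) => t w T2t /(semi_dist_far e20).
  rewrite ltr_pdivrMr// ltr_pMr// ltr1n => /(_ isT)[_ [b Bb <-] bA].
  by exists b.
move=> e e0; apply: vanish_sub (h _ e0) => t w T2t [b Bb bA].
by apply: semi_dist_ge => //; exists (phi t w b) => //; exists b.
Qed.

Lemma pullback_attracts A B :
  cvg0_in_probability P T2 (fun t w =>
    semi_dist (phi t (theta (- t) w) @` ysection B (theta (- t) w)) (A w)) ->
  attracts A B.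
Proof.
move=> /cvg0_in_probabilityP h e e0; apply: vanish_pullback.
apply: vanish_sub (h _ e0) => t w T2t [b Bb].
rewrite thetaNK; last exact: time_sub hT _ T2t.
by move=> bA; apply: semi_dist_ge => //; exists (phi t (theta (- t) w) b) => //; exists b.
Qed.

Lemma attracts_ae_sub A A' B : {ae P, forall w, A w `<=` A' w} ->
  attracts A B -> attracts A' B.
Proof.
move=> [N [mN N0 NP]] aB e e0; apply: vanish_up_to => eta eta0.
exists (fun t w => exists2 b, ysection B w b & ~ hits (A (theta t w)) (phi t w b) e), N.
split => //; [exact: aB|by rewrite [ltLHS]N0 lte_fin|].
move=> t w T2t [b Bb bA]; have [Nw|Nw] := pselect (N (theta t w)); [by right|left].
exists b => //; apply: contra_not bA; apply: hitsS.
by apply: contrapT => h; apply: Nw; exact: NP.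
Qed.

(** If the trajectories enter each V n, they approach Z, and so do their images
    under a random map. For f = phi t and Z an attracting set, this shows that the
    image of Z under phi t attracts. *)
Lemma shrinking_attracts V Z f B : shrinking q V Z -> random_map f ->
  (forall n, vanish (fun t w => exists2 b, ysection B w b &
                                ~ V n (phi t w b) (theta t w))) ->
  forall e : R, 0 < e -> vanish (fun t w => exists2 b, ysection B w b &
    ~ hits (f (theta t w) @` Z (theta t w)) (f (theta t w) (phi t w b)) e).
Proof.
move=> sV mf vV e e0; apply: vanish_up_to => eta eta0.
have [n [M [mM PM] MP]] := shrinking_near P q_dense sV mf e0 eta0.
exists (fun t w => exists2 b, ysection B w b & ~ V n (phi t w b) (theta t w)), M.
split => // t w T2t [b Bb bZ].
have [Mw|Mw] := pselect (M (theta t w)); [by right|left; exists b => //].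
by apply: contra_not bZ; exact: MP.
Qed.

Lemma constrained_attracts A f C B : rcompact A ->
  (forall k, random_map (f k)) -> (forall k, rcompact (C k)) ->
  attracts A B ->
  (forall k (e : R), 0 < e -> vanish (fun t w => exists2 b, ysection B w b &
     ~ hits (C k (theta t w)) (f k (theta t w) (phi t w b)) e)) ->
  attracts (constrained A f C) B.
Proof.
move=> cA mf cC aA aC e e0.
apply: (@vanish_sub _ _ _ _ _ _ (fun t w => exists2 b, ysection B w b &
    ~ hits ((fun=> id) (theta t w) @` constrained A f C (theta t w))
           ((fun=> id) (theta t w) (phi t w b)) e)).
  by move=> t w _; rewrite image_id.
apply: (shrinking_attracts (constrained_shrinking q_dense cA mf cC) random_map_id) => // n.
apply: vanish_sub (vanish_or (aA _ (tol_gt0 n))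
  (vanish_finite n (fun k => aC k _ (tol_gt0 n)))) => t w _ [b Bb bV].
have [bA|bA] := pselect (hits (A (theta t w)) (phi t w b) (tol n)); last first.
  by left; exists b.
right; apply: contrapT => h; apply: bV; split => // k kn; apply: contrapT => bC.
by apply: h; exists k => //; exists b.
Qed.

Definition attracting (BB : set (set (E * Omega))) : set (Omega -> set E) :=
  [set A | rcompact A /\ forall B, BB B -> attracts A B].

(** Strict invariance is not required of the sets C, so a least element is
    contained in more sets than a minimal attractor has to be; that excess is
    what forces invariance in [least_sub_image] and [least_image_sub]. *)
Definition least (BB : set (set (E * Omega))) A :=
  attracting BB A /\ forall C, attracting BB C -> {ae P, forall w, A w `<=` C w}.

Lemma attracting_bigcap BB (A : nat -> Omega -> set E) :
  (forall k, attracting BB (A k)) -> attracting BB (fun w => \bigcap_k A k w).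
Proof.
move=> aA; rewrite (_ : (fun w => _) = constrained (A 0%N) (fun=> fun=> id) A).
  have cA k : rcompact (A k) by case: (aA k).
  have mid (k : nat) : random_map (fun _ : Omega => @id E) by exact: random_map_id.
  split=> [|B BBB]; first exact: (constrained_rcompact q_dense (cA 0%N) mid cA).
  apply: (constrained_attracts (cA 0%N) mid cA) => [|k e].
    by case: (aA 0%N) => _; apply.
  by case: (aA k) => _ /(_ B BBB); apply.
apply/funext => w; apply/seteqP; split=> [x h|x [_ h] k _]; last exact: h.
by split=> [|k]; exact: h.
Qed.

Lemma least_exists BB : attracting BB !=set0 -> exists A, least BB A.
Proof.
move=> BB0; have [A aA AP] := essential_minimum P q_dense BB0
  (fun A (h : attracting BB A) => h.1) (@attracting_bigcap BB).
by exists A.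
Qed.

(** The set C obtained from A by running phi t from the state theta (- t) w is
    compact, and it attracts because trajectories that are close to A at time s
    are close to its image at time t + s. By leastness it contains A. *)
Lemma least_sub_image BB A t : least BB A -> T2 t -> 0 <= t ->
  {ae P, forall w, A (theta t w) `<=` phi t w @` A w}.
Proof.
move=> [[cA aA] lA] T2t t0; have T1t := time_sub hT T2t.
have mphi := random_map_phi T2t.
pose C w := phi t (theta (- t) w) @` A (theta (- t) w).
have /lA/(ae_theta T1t) : attracting BB C.
  split=> [|B BBB e e0].
    apply: (rcompact_theta (time1N hT T1t) (A := fun w => phi t w @` A w)).
    exact: (rcompact_image q_dense).
  apply/(vanish_shift _ T2t t0).
  have := shrinking_attracts (rcompact_shrinking q cA) mphi
    (fun n => aA B BBB _ (tol_gt0 n)) e0.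
  apply: vanish_sub => s w T2s [b Bb]; have T1s := time_sub hT T2s.
  rewrite phiD// (thetaD _ T1t T1s) /C thetaK// => bC.
  by exists b.
by apply: filterS => w; rewrite /C thetaK.
Qed.

(** A trajectory that is close to A both at time s and at time t + s is, by
    compactness, close to a point of A which phi t maps into A at theta t. So these
    points form an attracting set, which by leastness is all of A. *)
Lemma least_image_sub BB A t : least BB A -> T2 t -> 0 <= t ->
  {ae P, forall w, phi t w @` A w `<=` A (theta t w)}.
Proof.
move=> [[cA aA] lA] T2t t0; have T1t := time_sub hT T2t.
have mphi := random_map_phi T2t.
have cAt := rcompact_theta T1t cA.
have /lA : attracting BB (constrained A (fun=> phi t) (fun=> A \o theta t)).
  split=> [|B BBB].
    exact: (constrained_rcompact q_dense cA (fun=> mphi) (fun=> cAt)).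
  apply: (constrained_attracts cA (fun=> mphi) (fun=> cAt)) => [|_ e e0].
    exact: aA.
  have := (vanish_shift _ T2t t0).1 (aA B BBB e e0).
  apply: vanish_sub => s w T2s [b Bb] bA; have T1s := time_sub hT T2s.
  by exists b => //; rewrite phiD// thetaD.
by apply: filterS => w h _ [x /h[_ /(_ 0%N) ?] <-].
Qed.

Lemma least_attractor BB A : least BB A ->
  weak_random_attractor P theta T2 phi BB [set p | A p.2 p.1].
Proof.
move=> lA; have yA w : ysection [set p | A p.2 p.1] w = A w.
  by apply/seteqP; split=> [x /ysectionP|x Ax]//; apply/ysectionP.
split.
- by apply/compact_random_setP; case: lA => -[].
- move=> t T2t t0; apply: filterS2 (least_image_sub lA T2t t0)
    (least_sub_image lA T2t t0) => w h1 h2.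
  by rewrite !yA; apply/seteqP; split.
- move=> B BBB; have /attractsP : attracts A B by case: lA => -[_ +] _; apply.
  by under eq_fun do under eq_fun do rewrite -yA.
Qed.

Lemma attractor_attracting BB (C : set (E * Omega)) :
  weak_random_attractor P theta T2 phi BB C -> attracting BB (ysection C).
Proof.
have CE : C = [set p | ysection C p.2 p.1].
  by apply/seteqP; split=> [[x w] Cx|[x w] /=]; [apply/ysectionP|move=> /ysectionP].
move=> [cC _ aC]; split=> [|B /aC/attractsP//].
by apply/compact_random_setP; rewrite -CE.
Qed.

Lemma least_minimal BB A : least BB A ->
  minimal_weak_random_attractor P theta T2 phi BB [set p | A p.2 p.1].
Proof.
move=> lA; split; first exact: least_attractor.
move=> C /attractor_attracting/(lA.2); apply: filterS => w AC x /ysectionP Ax.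
exact: AC.
Qed.

(** The measurable modification of K has the same sections almost surely, and
    null events do not affect attraction in probability. *)
Lemma compact_attracting_set_attracting BB K :
  compact_attracting_set P theta T2 phi BB K ->
  exists2 A, attracting BB A & {ae P, forall w, A w = ysection K w}.
Proof.
move=> [mK cK aK]; have [A cA AK] := measurable_compact_rcompact q_dense mK cK.
exists A => //; split=> // B /aK/pullback_attracts; apply: attracts_ae_sub.
by apply: filterS AK => w ->.
Qed.

Lemma attracting_subfamily BB BB' A : BB' `<=` BB ->
  attracting BB A -> attracting BB' A.
Proof. by move=> BB'B [cA aA]; split=> // B /BB'B; exact: aA. Qed.

(** Let m D be the least attracting set of D; it grows with D. For the countable
    BB1 of [countable_subfamily], m BB1 almost surely contains m (BB1 + B), which
    attracts B. So m BB1 attracts all of BB, hence contains A almost surely, and A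
    inherits leastness for BB1. *)
Lemma least_countable_subfamily BB A : least BB A -> exists BB1,
  [/\ BB1 `<=` BB, countable BB1 & least BB1 A].
Proof.
move=> lA.
(* For D not contained in BB, A serves as a default value. *)
have /choice[m mP] : forall D : set (set (E * Omega)), exists C, D `<=` BB -> least D C.
  move=> D; have [DB|] := pselect (D `<=` BB); last by exists A.
  have [|C lC] := @least_exists D; last by exists C.
  by exists A; apply: attracting_subfamily DB _; case: lA.
have [D /mP[[]]//|D D' DD' D'B|BB1 [BB1B cBB1 BB1P]] :=
  @countable_subfamily _ _ _ _ P q q_dense _ BB m.
  have [_] := mP D (subset_trans DD' D'B); apply.
  by apply: attracting_subfamily DD' _; case: (mP D' D'B).
exists BB1; split => //; have [[cm am] lm] := mP BB1 BB1B.
have mBB : attracting BB (m BB1).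
  split=> // B BBB; have sB : BB1 `|` [set B] `<=` BB by move=> B' [/BB1B//|->].
  apply: attracts_ae_sub (BB1P B BBB) _.
  by have [[_ +] _] := mP _ sB; apply; right.
have Am : {ae P, forall w, A w `<=` m BB1 w} by exact: lA.2.
split; first by apply: attracting_subfamily BB1B _; case: lA.
by move=> C /lm; apply: filterS2 Am => w h1 h2; exact: subset_trans h2.
Qed.

End rds.

(** * Existence and minimality of weak attractors *)

Theorem theorem23 (R : realType) (E : completeMetricType R)
    (sepE : separable E)
    (d : measure_display) (Omega : measurableType d)
    (P : probability Omega R)
    (T1 T2 : set R) (hT : time_sets T1 T2)
    (theta : R -> Omega -> Omega)
    (htheta : metric_dynamical_system P T1 theta)
    (phi : R -> Omega -> E -> E)
    (hphi : random_dynamical_system theta T2 phi)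
    (BB : set (set (E * Omega))) :
  [/\ (exists K : set (E * Omega),
         compact_attracting_set P theta T2 phi BB K) ->
      exists A : set (E * Omega), weak_random_attractor P theta T2 phi BB A,
      (exists A : set (E * Omega),
         weak_random_attractor P theta T2 phi BB A) ->
      exists A : set (E * Omega),
        minimal_weak_random_attractor P theta T2 phi BB A /\
        exists BB1 : set (set (E * Omega)),
          [/\ BB1 `<=` BB, countable BB1 &
              minimal_weak_random_attractor P theta T2 phi BB1 A] &
      forall K A : set (E * Omega),
        compact_attracting_set P theta T2 phi BB K ->
        minimal_weak_random_attractor P theta T2 phi BB A ->
        {ae P, forall w, ysection A w `<=` ysection K w}].
Proof.
have [q q_dense] := separable_seq sepE.
split=> [[K aK]|[A' aA']|K A aK mA].
- have [A aA _] := compact_attracting_set_attracting q_dense hT htheta aK.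
  have [|A0 lA0] := least_exists q_dense hT htheta (phi := phi) (BB := BB).
    by exists A.
  by exists [set p | A0 p.2 p.1]; exact: (least_attractor q_dense hT htheta hphi).
- have [|A lA] := least_exists q_dense hT htheta (phi := phi) (BB := BB).
    by exists (ysection A'); exact: attractor_attracting.
  have [BB1 [BB1B cBB1 lA1]] := least_countable_subfamily q_dense hT htheta lA.
  exists [set p | A p.2 p.1]; split.
    exact: (least_minimal q_dense hT htheta hphi lA).
  exists BB1; split => //.
  exact: (least_minimal q_dense hT htheta hphi lA1).
- have [C aC CK] := compact_attracting_set_attracting q_dense hT htheta aK.
  have [|L lL] := least_exists q_dense hT htheta (phi := phi) (BB := BB).
    by exists C.
  have AL := mA.2 _ (least_attractor q_dense hT htheta hphi lL).
  apply: filterS3 AL (lL.2 _ aC) CK => w AL LC <- x /AL /ysectionP; exact: LC.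
Qed.
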